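(* Let $H$ be a monoid and let $r$ be a finitary ideal system on $H$. (A) The following are equivalent: (1) $\mathcal{I}_r^*(H)$ is radical factorial. (2) Each $I\in\mathcal{I}_r^*(H)$ is a finite $r$-product of radical $r$-ideals of $H$. (3) $\bigcap_{P\in\mathfrak{X}(H)}H_P=H$, $H_Q$ is a DVM for all $Q\in\mathfrak{X}(H)$, and for each $I\in\mathcal{I}_r^*(H)$, $\sqrt I=\bigcap_{J\in\Omega}J$ for some $(r,I)$-meager set $\Omega\subseteq\mathcal{I}_r^*(H)$. (B) $H$ is radical factorial if and only if $\bigcap_{P\in\mathfrak{X}(H)}H_P=H$, $H_Q$ is a DVM for each $Q\in\mathfrak{X}(H)$, and for each $x\in H$, $\sqrt{xH}=\bigcap_{J\in\Omega}J$ for some $(t,xH)$-meager set $\Omega$ of principal ideals of $H$.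
   Context: Monoids. A monoid $H$ is a commutative semigroup with identity and more than one element in which every nonzero element is cancellative. Here $z(H)=\{z\in H: zx=z \text{ for all } x\in H\}$ ($|z(H)|\le 1$, possibly empty); ''nonzero'' means not in $z(H)$; $H^{\bullet}=H\setminus z(H)$; $G=(H^{\bullet})^{-1}H$ is the quotient monoid; $\mathbb{N}$ is the set of positive integers. For $X\subseteq H$, $\sqrt X=\{x\in H: x^n\in X\text{ for some }n\in\mathbb{N}\}$; for $Y\subseteq G$, $Y^{-1}=\{z\in G: zY\subseteq H\}$. $X\subseteq H$ is an $s$-ideal if $X=XH\cup z(H)$; radical if $\sqrt X=X$; proper if $X\ne H$. A principal ideal is a set $AH\cup z(H)$ with $A\subseteq H$, $|A|\le 1$. A prime $s$-ideal is a proper $s$-ideal $P$ such that $xy\in P$ implies $x\in P$ or $y\in P$; $H_P=(H\setminus P)^{-1}H$. $\mathfrak{X}(H)$ is the set of minimal elements among the prime $s$-ideals properly containing $z(H)$. Intersections of localizations are formed inside $G$ (the empty one being $G$). A monoid different from its quotient monoid is a DVM (discrete valuation monoid) if all its $s$-ideals are principal. A monoid is radical factorial if every principal ideal is a finite product of radical principal ideals. Ideal systems. A finitary ideal system on $H$ is a map $r:\mathbb{P}(H)\to\mathbb{P}(H)$, $X\mapsto X_r$ such that for all $X,Y\subseteq H$, $c\in H$: $XH\cup z(H)\subseteq X_r$; $X\subseteq Y_r$ implies $X_r\subseteq Y_r$; $cX_r=(cX)_r$; $X_r=\bigcup_{E\subseteq X,|E|<\infty}E_r$. An $r$-ideal is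 an $X\subseteq H$ with $X_r=X$; it is $r$-invertible if $(XX^{-1})_r=H$. $\mathcal{I}_r^*(H)$ is the set of $r$-invertible $r$-ideals, which is a monoid under $r$-multiplication $(I,J)\mapsto(IJ)_r$; finite $r$-products are formed accordingly. The $t$-system: if $H=G$, $X_t=z(H)$ if $X\subseteq z(H)$ and $X_t=H$ otherwise; if $H\ne G$, $X_t=\bigcup_{E\subseteq X,|E|<\infty}E_v$ with $X_v=(X^{-1})^{-1}$; it is a finitary ideal system. Meager sets. Let $\Omega$ be a finite set of $r$-ideals of $H$ and $I$ an $r$-ideal. For $P\in\mathfrak{X}(H)$ let $k_P$ be the number of elements of $\Omega$ contained in $P$. $\Omega$ is $(r,I)$-meager if $I\subseteq(P^{k_P})_r$ for each $P\in\mathfrak{X}(H)$ (with $P^0=H$). *)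

(* Defs.v *)
From HB Require Import structures.
From mathcomp Require Import all_boot.
From mathcomp Require Export monoid.
From mathcomp Require Export finmap.
From mathcomp Require Export mathcomp_extra boolp classical_sets functions.
From mathcomp Require Export cardinality.

Set Implicit Arguments.
Unset Strict Implicit.
Unset Printing Implicit Defensive.

Local Open Scope classical_set_scope.
Local Open Scope group_scope.

HB.mixin Record Monoid_isCommutative M of Monoid M := {
  mulgC : commutative (@mul M)
}.

#[short(type="comMonoidType")]
HB.structure Definition ComMonoid :=
  {M of Monoid M & Monoid_isCommutative M}.

Lemma mulgAC (M : comMonoidType) : right_commutative (@mul M).
Proof. by move=> x y z; rewrite -!mulgA [y * z]mulgC. Qed.

Lemma mulgCA (M : comMonoidType) : left_commutative (@mul M).
Proof. by move=> x y z; rewrite !mulgA [x * y]mulgC. Qed.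

Lemma mulgACA (M : comMonoidType) : interchange (@mul M) (@mul M).
Proof. by move=> x y z t; rewrite -!mulgA [y * (z * t)]mulgCA. Qed.

Definition zeros {M : comMonoidType} : set M :=
  [set z | forall x, z * x = z].

(* The monoids of the theory of ideal systems: commutative, with at least two
   elements, every nonzero element being cancellative.  The weaker structure
   [comMonoidType] is kept because the monoid of r-invertible r-ideals has a
   single element when H is its own quotient monoid. *)
HB.mixin Record ComMonoid_isCancellative M of ComMonoid M := {
  more_than_one : exists x y : M, x <> y;
  nonzero_cancel_subproof : forall x : M, ~ zeros x ->
    forall y z : M, x * y = x * z -> y = z
}.

#[short(type="cancelMonoidType")]
HB.structure Definition CancelMonoid :=
  {M of ComMonoid M & ComMonoid_isCancellative M}.

Lemma nonzero_cancel {M : cancelMonoidType} {x : M} : ~ zeros x ->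
  forall y z : M, x * y = x * z -> y = z.
Proof. exact: nonzero_cancel_subproof. Qed.

Section SIdeals.
Context {M : comMonoidType}.
Implicit Types (X Y P : set M).

Definition setmul X Y : set M := [set x * y | x in X & y in Y].

(* P^0 is the whole monoid, so P^1 = PM, which is P for an s-ideal P. *)
Definition setpow X (n : nat) : set M := iter n (setmul X) setT.

Definition smul (c : M) X : set M := [set c * x | x in X].

Definition rad X : set M := [set x | exists n : nat, (0 < n)%N /\ X (x ^+ n)].

Definition radical X : Prop := rad X = X.

Definition s_ideal X : Prop := X = setmul X setT `|` zeros.

Definition principal X : Prop :=
  exists A : set M, is_subset1 A /\ X = setmul A setT `|` zeros.

Definition prime_s_ideal P : Prop :=
  [/\ s_ideal P, P <> setT & forall x y, P (x * y) -> P x \/ P y].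

Definition minimal_primes : set (set M) :=
  [set P | [/\ prime_s_ideal P, zeros `<` P &
    forall Q, prime_s_ideal Q -> zeros `<` Q -> Q `<=` P -> Q = P]].

End SIdeals.

Arguments minimal_primes M : clear implicits.

Definition radical_factorial (M : comMonoidType) : Prop :=
  forall X : set M, principal X ->
    exists s : seq (set M),
      (forall Y, Y \in s -> principal Y /\ radical Y) /\
      X = foldr setmul setT s.

Section Fractions.
Variable H : cancelMonoidType.

Lemma one_nonzero : ~ @zeros H 1.
Proof.
move=> z1; have [x [y xy]] := @more_than_one H; apply: xy.
by rewrite -[x]mul1g -[y]mul1g !z1.
Qed.

Lemma mul_nonzero (x y : H) : ~ zeros x -> ~ zeros y -> ~ zeros (x * y).
Proof.
move=> nx ny zxy; apply: ny => w; apply: (nonzero_cancel nx).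
by rewrite mulgA zxy.
Qed.

Definition nonzero : Type := {s : H | s \in ~` zeros}.
HB.instance Definition _ := [Choice of nonzero by <:].

Lemma nonzeroP (s : nonzero) : ~ zeros (val s).
Proof. by have := valP s; rewrite inE. Qed.
Arguments nonzeroP : clear implicits.

Definition mknonzero (s : H) (hs : ~ zeros s) : nonzero :=
  exist _ s (mem_set hs).

(* (a, s) and (b, t) represent the same fraction when at = bs. *)
Definition frac_eq : rel (H * nonzero) :=
  fun p q => p.1 * val q.2 == q.1 * val p.2.

Lemma frac_eq_refl : reflexive frac_eq.
Proof. by move=> p; rewrite /frac_eq. Qed.

Lemma frac_eq_sym : symmetric frac_eq.
Proof. by move=> p q; rewrite /frac_eq eq_sym. Qed.

Lemma frac_eq_trans : transitive frac_eq.
Proof.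
move=> [b t] [a s] [c u]; rewrite /frac_eq /= => /eqP e1 /eqP e2.
apply/eqP/(nonzero_cancel (nonzeroP t)).
by rewrite mulgCA mulgA e1 mulgAC e2 mulgAC mulgC.
Qed.

Canonical frac_equiv := EquivRel frac_eq frac_eq_refl frac_eq_sym frac_eq_trans.

Definition frac : Type := {eq_quot frac_equiv}%qT.
HB.instance Definition _ := Choice.on frac.

Definition mkfrac (a : H) (s : nonzero) : frac := \pi_{eq_quot frac_equiv}%qT (a, s).

Lemma mkfracP a s b t : mkfrac a s = mkfrac b t <-> a * val t = b * val s.
Proof.
rewrite /mkfrac; split.
  by move=> /eqP; rewrite eqmodE => /eqP.
by move=> e; apply/eqP; rewrite eqmodE; apply/eqP.
Qed.

Lemma frac_ind (K : frac -> Prop) : (forall a s, K (mkfrac a s)) -> forall x, K x.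
Proof. by move=> h x; elim/quotW: x => -[a s]; exact: h. Qed.

Definition nonzero_one : nonzero := mknonzero one_nonzero.
Definition nonzero_mul (s t : nonzero) : nonzero :=
  mknonzero (mul_nonzero (nonzeroP s) (nonzeroP t)).

Definition frac_inj (a : H) : frac := mkfrac a nonzero_one.

Definition frac_one : frac := frac_inj 1.

Definition frac_mul (x y : frac) : frac :=
  let p := repr x in let q := repr y in
  mkfrac (p.1 * q.1) (nonzero_mul p.2 q.2).

Lemma repr_mkfrac a s : 
  (repr (mkfrac a s)).1 * val s = a * val (repr (mkfrac a s)).2.
Proof.
by apply/mkfracP; rewrite {3}/mkfrac -[RHS]reprK /mkfrac; case: (repr _).
Qed.

Lemma mkfracM a s b t :
  frac_mul (mkfrac a s) (mkfrac b t) = mkfrac (a * b) (nonzero_mul s t).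
Proof.
rewrite /frac_mul; apply/mkfracP => /=.
by rewrite mulgACA !repr_mkfrac mulgACA.
Qed.

Lemma frac_mulC : commutative frac_mul.
Proof.
elim/frac_ind=> a s; elim/frac_ind=> b t; rewrite !mkfracM; apply/mkfracP => /=.
by rewrite [b * a]mulgC [val t * _]mulgC.
Qed.

Lemma frac_mulA : associative frac_mul.
Proof.
elim/frac_ind=> a s; elim/frac_ind=> b t; elim/frac_ind=> c u.
by rewrite !mkfracM; apply/mkfracP => /=; rewrite !mulgA.
Qed.

Lemma frac_mul1 : left_id frac_one frac_mul.
Proof.
elim/frac_ind=> a s; rewrite mkfracM; apply/mkfracP => /=.
by rewrite !mul1g.
Qed.

Lemma frac_mulr1 : right_id frac_one frac_mul.
Proof. by move=> x; rewrite frac_mulC frac_mul1. Qed.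

HB.instance Definition _ :=
  isMonoid.Build frac frac_mulA frac_mul1 frac_mulr1.
HB.instance Definition _ := Monoid_isCommutative.Build frac frac_mulC.

Lemma frac_injM (a b : H) : frac_inj (a * b) = frac_inj a * frac_inj b.
Proof. by rewrite /frac_inj /mul/= mkfracM; apply/mkfracP => /=; rewrite !mulg1. Qed.

Lemma frac_inj1 : frac_inj 1 = 1.
Proof. by []. Qed.

Lemma frac_inj_injective : injective frac_inj.
Proof. by move=> a b /mkfracP /=; rewrite !mulg1. Qed.

Lemma frac_denom (x : frac) :
  exists a s, ~ zeros s /\ x * frac_inj s = frac_inj a.
Proof.
elim/frac_ind: x => a s; exists a, (val s); split; first exact: nonzeroP.
by rewrite /mul/= mkfracM; apply/mkfracP => /=; rewrite !mulg1.
Qed.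

Lemma frac_inj_inv (s : H) : ~ zeros s -> exists y, frac_inj s * y = 1.
Proof.
move=> hs; exists (mkfrac 1 (mknonzero hs)).
by rewrite /mul/= mkfracM; apply/mkfracP => /=; rewrite mulg1 !mul1g mulg1.
Qed.

Lemma frac_more_than_one : exists x y : frac, x <> y.
Proof.
have [x [y xy]] := @more_than_one H; exists (frac_inj x), (frac_inj y).
by move/frac_inj_injective.
Qed.

Lemma frac_nonzero_inv (x : frac) : ~ zeros x -> exists y, x * y = 1.
Proof.
move=> nx; have [a [s [hs e]]] := frac_denom x.
have [t est] := frac_inj_inv hs.
have [za|nza] := pselect (zeros a).
  exfalso; apply: nx => w; have [b [u [hu e']]] := frac_denom w.
  have [v euv] := frac_inj_inv hu.
  have zf c : frac_inj a * frac_inj c = frac_inj a by rewrite -frac_injM za.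
  have zu : frac_inj a * v = frac_inj a.
    by rewrite -{1}(zf u) -mulgA euv mulg1.
  have -> : w = frac_inj b * v by rewrite -e' -mulgA euv mulg1.
  have -> : x = frac_inj a * t by rewrite -e -mulgA est mulg1.
  by rewrite -mulgA [t * _]mulgC mulgA mulgA zf zu.
have [b eab] := frac_inj_inv nza; exists (frac_inj s * b).
by rewrite mulgA e eab.
Qed.

Lemma frac_nonzero_cancel (x : frac) : ~ zeros x ->
  forall y z, x * y = x * z -> y = z.
Proof.
move=> /frac_nonzero_inv[w xw] y z e.
by rewrite -[y]mul1g -[z]mul1g -xw [x * w]mulgC -!mulgA e.
Qed.

HB.instance Definition _ :=
  ComMonoid_isCancellative.Build frac frac_more_than_one frac_nonzero_cancel.

End Fractions.

Arguments frac_inj {H} a.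

(* The elements s^-1 h with s outside P. *)
Definition local_set {H : cancelMonoidType} (P : set H) : set (frac H) :=
  [set x | exists s h : H, ~ P s /\ x * frac_inj s = frac_inj h].

Section Localization.
Context {H : cancelMonoidType}.
Variables (P : set H) (Pprime : prime_s_ideal P).

Lemma prime_not1 : ~ P 1.
Proof.
move=> P1; case: Pprime => PE PT _; apply: PT; apply/seteqP; split=> // x _.
by rewrite PE; left; exists 1 => //; exists x => //; rewrite mul1g.
Qed.

Lemma local_set1 : local_set P 1.
Proof. by exists 1, 1; split; [exact: prime_not1|rewrite mul1g]. Qed.

Lemma local_setM x y : local_set P x -> local_set P y -> local_set P (x * y).
Proof.
move=> [s [h [hs es]]] [t [k [ht et]]]; exists (s * t), (h * k); split.
  by case: Pprime => _ _ pr /pr[].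
rewrite !frac_injM -es -et -!mulgA; congr (_ * _).
by rewrite !mulgA; congr (_ * _); exact: mulgC.
Qed.

Lemma local_set_inj a : local_set P (frac_inj a).
Proof. by exists 1, a; split; [exact: prime_not1|rewrite frac_inj1 mulg1]. Qed.

(* The primality proof is a parameter so that the monoid structure below can be
   attached to the type. *)
Definition localization of prime_s_ideal P : Type :=
  {x : frac H | x \in local_set P}.

Local Notation L := (localization Pprime).

HB.instance Definition _ := SubChoice.on L.

Lemma local_closed : monoid_closed [pred x | x \in local_set P].
Proof.
split; first by rewrite !inE; exact: local_set1.
by move=> x y; rewrite !inE; exact: local_setM.
Qed.

HB.instance Definition _ :=
  SubChoice_isSubMonoid.Build (frac H) _ L local_closed.

Lemma local_mulC : commutative (@mul L).
Proof. by move=> x y; apply: val_inj; rewrite !valM mulgC. Qed.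

HB.instance Definition _ := Monoid_isCommutative.Build L local_mulC.

Lemma local_more_than_one : exists x y : L, x <> y.
Proof.
have [x [y xy]] := @more_than_one H.
pose f a : L := exist _ (frac_inj a) (mem_set (local_set_inj a)).
exists (f x), (f y).
by move=> /(congr1 val) /= /frac_inj_injective.
Qed.

Lemma local_nonzero_cancel (x : L) : ~ zeros x ->
  forall y z, x * y = x * z -> y = z.
Proof.
move=> nx y z /(congr1 val); rewrite !valM => e; apply: val_inj.
apply: nonzero_cancel e => zx; apply: nx => w.
by apply: val_inj; rewrite valM zx.
Qed.

HB.instance Definition _ := ComMonoid_isCancellative.Build L
  local_more_than_one local_nonzero_cancel.

End Localization.

Definition DVM (M : cancelMonoidType) : Prop :=
  range (@frac_inj M) <> setT /\ forall X : set M, s_ideal X -> principal X.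

Record finitary_ideal_system (H : comMonoidType) := FinitaryIdealSystem {
  closure :> set H -> set H;
  closure_sub : forall X, setmul X setT `|` zeros `<=` closure X;
  closure_le : forall X Y, X `<=` closure Y -> closure X `<=` closure Y;
  closure_smul : forall c X, smul c (closure X) = closure (smul c X);
  closure_finitary : forall X,
    closure X = \bigcup_(E in [set E | E `<=` X /\ finite_set E]) closure E
}.

(* Y^-1, for a subset Y of the quotient monoid. *)
Definition inv_set {H : cancelMonoidType} (Y : set (frac H)) : set (frac H) :=
  [set z | smul z Y `<=` range frac_inj].

Section IdealOperators.
Context {H : cancelMonoidType}.
Implicit Types (r : set H -> set H) (X I P : set H) (Omega : set (set H)).

Definition r_ideal r X : Prop := r X = X.

(* X X^-1, which is contained in H. *)
Definition mul_inv X : set H :=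
  frac_inj @^-1` setmul (frac_inj @` X) (inv_set (frac_inj @` X)).

Definition r_invertible r X : Prop := r (mul_inv X) = setT.

Definition invertible_r_ideals r : set (set H) :=
  [set I | r_ideal r I /\ r_invertible r I].

Definition r_mul r X Y : set H := r (setmul X Y).

Definition v_closure X : set H :=
  frac_inj @^-1` inv_set (inv_set (frac_inj @` X)).

Definition t_closure X : set H :=
  if pselect (range (@frac_inj H) = setT) then
    if pselect (X `<=` zeros) then zeros else setT
  else \bigcup_(E in [set E | E `<=` X /\ finite_set E]) v_closure E.

Definition count_below Omega P : nat :=
  #|` fset_set [set J | Omega J /\ J `<=` P] |.

Definition meager r I Omega : Prop :=
  [/\ finite_set Omega, (forall J, Omega J -> r_ideal r J), r_ideal r I &
    forall P, minimal_primes H P -> I `<=` r (setpow P (count_below Omega P))].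

End IdealOperators.

Section InvertibleIdeals.
Context {H : cancelMonoidType}.
Variable r : finitary_ideal_system H.
Implicit Types (X Y Z I J : set H).

Lemma closure_id_sub X : X `<=` r X.
Proof.
by move=> x Xx; apply: closure_sub; left; exists x => //; exists 1 => //; rewrite mulg1.
Qed.

Lemma closure_mono X Y : X `<=` Y -> r X `<=` r Y.
Proof. by move=> XY; apply: closure_le => x /XY; exact: closure_id_sub. Qed.

Lemma closure_idem X : r (r X) = r X.
Proof. by apply/seteqP; split; [exact: closure_le|exact: closure_id_sub]. Qed.

Lemma closureT : r setT = setT.
Proof. by apply/seteqP; split=> // x _; exact: closure_id_sub. Qed.

Lemma setmulC X Y : setmul X Y = setmul Y X.
Proof.
by apply/seteqP; split=> _ [x Xx [y Yy <-]]; exists y => //; exists x => //;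
  exact: mulgC.
Qed.

Lemma setmulA X Y Z : setmul X (setmul Y Z) = setmul (setmul X Y) Z.
Proof.
apply/seteqP; split.
  move=> _ [x Xx [_ [y Yy [z Zz <-]] <-]]; exists (x * y); first by exists x => //; exists y.
  by exists z => //; rewrite mulgA.
move=> _ [_ [x Xx [y Yy <-]] [z Zz <-]]; exists x => //; exists (y * z).
  by exists y => //; exists z.
by rewrite mulgA.
Qed.

Lemma setmul_mono X X' Y Y' : X `<=` X' -> Y `<=` Y' -> setmul X Y `<=` setmul X' Y'.
Proof. by move=> XX YY _ [x /XX Xx [y /YY Yy <-]]; exists x => //; exists y. Qed.

Lemma closure_mull X Y : r (setmul (r X) Y) = r (setmul X Y).
Proof.
apply/seteqP; split; last first.
  by apply: closure_mono; apply: setmul_mono => //; exact: closure_id_sub.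
apply: closure_le => _ [x rXx [y Yy <-]].
have : smul y (r X) (x * y) by exists x => //; exact: mulgC.
rewrite closure_smul; apply: closure_mono => _ [x' Xx' <-].
by exists x' => //; exists y => //; exact: mulgC.
Qed.

Lemma closure_mulr X Y : r (setmul X (r Y)) = r (setmul X Y).
Proof. by rewrite setmulC closure_mull setmulC. Qed.

Lemma r_ideal_mulT I : r_ideal r I -> setmul I setT = I.
Proof.
move=> rI; apply/seteqP; split=> [x Ix|x Ix].
  by rewrite -rI; apply: closure_sub; left.
by exists x => //; exists 1 => //; rewrite mulg1.
Qed.

Lemma invertibleT : invertible_r_ideals r setT.
Proof.
split; first exact: closureT.
apply/seteqP; split=> // x _; apply: closure_id_sub.
exists (frac_inj x); first by exists x.
exists 1; last by rewrite mulg1.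
by move=> _ [_ [y _ <-] <-]; exists y => //; rewrite mul1g.
Qed.

Lemma inv_set_closure X (w : frac H) :
  inv_set (frac_inj @` X) w -> inv_set (frac_inj @` (r X)) w.
Proof.
move=> wX _ [_ [x rXx <-] <-]; have [a [c [hc e]]] := frac_denom w.
have [d ecd] := frac_inj_inv hc.
have sub : smul a X `<=` smul c (r setT).
  move=> _ [y Xy <-]; have [|h _ eh] := wX (w * frac_inj y).
    by exists (frac_inj y) => //; exists y.
  exists h; first by rewrite closureT.
  apply: frac_inj_injective; rewrite !frac_injM eh mulgA -e.
  by rewrite [_ c * w]mulgC.
have : smul a (r X) (a * x) by exists x.
rewrite closure_smul => ax.
have : smul c (r setT) (a * x).
  rewrite closure_smul; apply: closure_le ax => z /sub.
  by rewrite closure_smul.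
move=> [h _ eh]; exists h => //.
have /(congr1 frac_inj) := eh; rewrite !frac_injM -e => eh'.
by rewrite -[LHS]mul1g -ecd [_ c * d]mulgC -mulgA eh' -!mulgA mulgA
  [d * _]mulgC -mulgA [d * _]mulgA [d * _]mulgC ecd mul1g.
Qed.

Lemma invertibleM I J : invertible_r_ideals r I -> invertible_r_ideals r J ->
  invertible_r_ideals r (r_mul r I J).
Proof.
move=> [rI iI] [rJ iJ]; split; first exact: closure_idem.
have sub : setmul (mul_inv I) (mul_inv J) `<=` mul_inv (r_mul r I J).
  move=> _ [x Ix [y Jy <-]].
  case: Ix => _ [a Ia <-] [u uI eu]; case: Jy => _ [b Jb <-] [v vJ ev].
  exists (frac_inj (a * b)).
    by exists (a * b) => //; apply: closure_id_sub; exists a => //; exists b.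
  exists (u * v).
    apply: inv_set_closure => _ [_ [_ [c Ic [d Jd <-]] <-] <-].
    have [|h _ eh] := uI (u * frac_inj c); first by exists (frac_inj c) => //; exists c.
    have [|k _ ek] := vJ (v * frac_inj d); first by exists (frac_inj d) => //; exists d.
    exists (h * k) => //; rewrite !frac_injM eh ek -!mulgA; congr (_ * _).
    by rewrite !mulgA; congr (_ * _); exact: mulgC.
  rewrite !frac_injM -eu -ev -!mulgA; congr (_ * _).
  by rewrite !mulgA; congr (_ * _); exact: mulgC.
rewrite /r_invertible; apply/seteqP; split=> // x _.
apply: (closure_mono sub); rewrite -closure_mull -closure_mulr.
rewrite iI iJ; apply: closure_id_sub; exists x => //; exists 1 => //.
exact: mulg1.
Qed.

Definition inv_ideal : Type := {I : set H | I \in invertible_r_ideals r}.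
HB.instance Definition _ := [Choice of inv_ideal by <:].

Lemma inv_idealP (I : inv_ideal) : invertible_r_ideals r (val I).
Proof. by have := valP I; rewrite inE. Qed.

Definition inv_ideal_one : inv_ideal := exist _ setT (mem_set invertibleT).
Definition inv_ideal_mul (I J : inv_ideal) : inv_ideal :=
  exist _ (r_mul r (val I) (val J))
    (mem_set (invertibleM (inv_idealP I) (inv_idealP J))).

Lemma inv_ideal_mulA : associative inv_ideal_mul.
Proof.
by move=> I J K; apply: val_inj; rewrite /= /r_mul closure_mulr closure_mull setmulA.
Qed.

Lemma inv_ideal_mulC : commutative inv_ideal_mul.
Proof. by move=> I J; apply: val_inj; rewrite /= /r_mul setmulC. Qed.

Lemma inv_ideal_mulr1 : right_id inv_ideal_one inv_ideal_mul.
Proof.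
move=> I; apply: val_inj; have [rI _] := inv_idealP I.
by rewrite /= /r_mul r_ideal_mulT.
Qed.

Lemma inv_ideal_mul1 : left_id inv_ideal_one inv_ideal_mul.
Proof. by move=> I; rewrite inv_ideal_mulC inv_ideal_mulr1. Qed.

HB.instance Definition _ :=
  isMonoid.Build inv_ideal inv_ideal_mulA inv_ideal_mul1 inv_ideal_mulr1.
HB.instance Definition _ := Monoid_isCommutative.Build inv_ideal inv_ideal_mulC.

End InvertibleIdeals.

(* Main.v *)
Require Import Defs.
From mathcomp Require Import all_boot classical_sets.

Set Implicit Arguments.
Unset Strict Implicit.
Unset Printing Implicit Defensive.

Local Open Scope classical_set_scope.
Local Open Scope group_scope.

(** All the equivalences come from one theorem on a finitary ideal system r:
    the r-invertible r-ideals are r-products of radical r-ideals if and only if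
    H is the intersection of the discrete valuation monoids H_P, P in X(H), and
    the radicals of invertible ideals are intersections of meager sets.

    - Factoring in the monoid of invertible ideals is the same as factoring in
      H, since containment of invertible ideals is divisibility
      ([invertible_divides]), so that an invertible ideal J is radical in H
      exactly when it generates a radical principal ideal
      ([inv_ideal_radical]).
    - Factoring elements of H is the case where the r-ideals are all the
      s-ideals: the invertible ideals are then the nonzero principal ideals
      ([s_system_invertible]).  There the t-system may replace the s-system in
      the meagerness condition, because for P in X(H) the closure of P^k by
      either system lies in the localization of P^k
      ([closure_setpow_local], [t_closure_setpow_local]).

    Localizations are handled through elements.  For P in X(H), every nonzero x
    divides some s y^n with s outside P and y in P arbitrary
    ([minimal_prime_divides]).  Hence P is an r-ideal, and H_P is a discrete
    valuation monoid if and only if some a in P divides, up to a factor outside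
    P, every element of P ([uniformizer]).

    Suppose that invertible ideals factor into radical ones.  If P in X(H)
    contains a nonzero x, then it contains a radical factor I of xH; locally at
    P this I is both equal to P and principal, which yields a uniformizer.
    Conversely a prime r-ideal with a uniformizer is in X(H)
    ([uniformizer_minimal]); by Krull's lemma a radical invertible ideal is
    therefore the intersection of the P in X(H) that contain it.  Dividing by
    one radical factor after the other, one obtains that a product of radical
    invertible ideals is determined by its localizations at X(H)
    ([r_prod_local_global]); for principal ideals this is the equality of H
    with the intersection of the H_P.  The factors of I form a meager set with
    intersection the radical of I.

    Suppose conversely that the conditions on localizations hold.  Then every
    invertible ideal is determined by its localizations
    ([invertible_local_global]).  Let the radical of I be the intersection of
    the meager set Omega.  If I is contained in P, then the members of Omega
    lie between the radical of I and H, so locally at P each is P or H;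
    therefore all of them are radical ([member_radical]), and meagerness says
    exactly that their product K contains I ([meager_subset_r_prod]).  Write
    I = (K I')_r and continue with I'.  This ends because some power of K lies
    in I: the valuations of I are bounded uniformly in P, and each step lowers
    the bound ([exists_valuation_le], [valuation_le_div]). *)

Local Notation "x %:F" := (frac_inj x) (at level 2, format "x %:F").

(** Proves that two products agree up to the order of the factors, by cancelling
    the leading factor of the left-hand side. *)
Ltac comm_mul :=
  rewrite -?mulgA;
  repeat first
    [ reflexivity
    | match goal with
      | |- ?x * _ = ?x * _ => congr (x * _)
      | |- ?x * _ = ?r =>
          match r with
          | context [?b * (x * ?c)] => progress rewrite [b * (x * c)]mulgCA
          | context [?b * x] => progress rewrite [b * x]mulgC
          end
      end ].

(** * Zero elements and cancellation *)

Section SIdealTheory.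
Variable H : cancelMonoidType.
Implicit Types (X Y I P Q : set H) (x y z s : H).

Lemma expgMC (M : comMonoidType) (x y : M) n : (x * y) ^+ n = x ^+ n * y ^+ n.
Proof. by apply: expgMn; exact: mulgC. Qed.

Lemma zerosM z x : zeros z -> zeros (z * x).
Proof. by move=> zz y; rewrite -mulgA !zz. Qed.

Lemma zeros_uniq z x : zeros z -> zeros x -> z = x.
Proof. by move=> zz zx; rewrite -(zz x) mulgC zx. Qed.

Lemma nonzeroM_l x y : ~ zeros (x * y) -> ~ zeros x.
Proof. by move=> nxy zx; apply: nxy; exact: zerosM. Qed.

Lemma nonzero_exp x n : ~ zeros x -> ~ zeros (x ^+ n).
Proof.
move=> nx; elim: n => [|n IHn]; first exact: one_nonzero.
by rewrite expgS; exact: mul_nonzero.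
Qed.

Lemma frac_cancel s : ~ zeros s -> forall u v : frac H,
  s%:F * u = s%:F * v -> u = v.
Proof.
move=> ns u v e; have [w sw] := frac_inj_inv ns.
by rewrite -[u]mul1g -[v]mul1g -sw ![_ * w]mulgC -!mulgA e.
Qed.

(** Multiplying by a denominator of u gives b c = h d inside H, where zero is
    absorbing. *)
Lemma frac_factor_nonzero b h (u : frac H) : b%:F * u = h%:F -> ~ zeros h ->
  ~ zeros b.
Proof.
move=> bu nh zb; have [c [d [nd e]]] := frac_denom u.
apply: (mul_nonzero nh nd).
rewrite (_ : h * d = b * c); first exact: zerosM.
by apply: frac_inj_injective; rewrite !frac_injM -e -bu mulgA.
Qed.

(** * Prime ideals *)

Lemma s_idealM I x y : s_ideal I -> I x -> I (x * y).
Proof.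
move=> ->[[a Ia [b _ <-]]|zx]; last by right; exact: zerosM.
by left; exists a => //; exists (b * y); rewrite ?mulgA.
Qed.

Lemma s_ideal_zeros I : s_ideal I -> zeros `<=` I.
Proof. by move=> -> x zx; right. Qed.

Lemma s_idealP I : (forall x y, I x -> I (x * y)) -> zeros `<=` I -> s_ideal I.
Proof.
move=> IM I0; apply/seteqP; split=> [x Ix|x [[a Ia [b _ <-]]|/I0//]].
  by left; exists x => //; exists 1; rewrite ?mulg1.
exact: IM.
Qed.

Section Prime.
Variables (P : set H) (Pprime : prime_s_ideal P).

Lemma primeMr x y : P x -> P (x * y).
Proof. by case: Pprime => PS _ _; exact: s_idealM. Qed.

Lemma primeMl x y : P y -> P (x * y).
Proof. by rewrite mulgC; exact: primeMr. Qed.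

Lemma prime_zeros : zeros `<=` P.
Proof. by case: Pprime => PS _ _; exact: s_ideal_zeros. Qed.

Lemma prime_notin x : ~ P x -> ~ zeros x.
Proof. by move=> Px /prime_zeros. Qed.

Lemma prime_notinM x y : ~ P x -> ~ P y -> ~ P (x * y).
Proof. by case: Pprime => _ _ pr nx ny /pr[]. Qed.

Lemma prime_notin_exp x n : ~ P x -> ~ P (x ^+ n).
Proof.
move=> nx; elim: n => [|n IHn]; first exact: prime_not1.
by rewrite expgS; exact: prime_notinM.
Qed.

Lemma prime_exp x n : P (x ^+ n) -> P x.
Proof. by move=> Pxn; apply: contrapT => /(@prime_notin_exp _ n). Qed.

End Prime.

(** The complement of a divisor-closed submonoid is a prime ideal, which is how
   all the prime ideals below are produced. *)
Lemma prime_setC (S : set H) : S 1 -> (forall x y, S (x * y) <-> S x /\ S y) ->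
  (forall x, S x -> ~ zeros x) -> prime_s_ideal (~` S).
Proof.
move=> S1 SM S0; split.
- apply: s_idealP => [x y nx /SM[]//|x zx Sx]; exact: S0 zx.
- by move=> e; have : (~` S) 1 by rewrite e.
- by move=> x y nxy; apply: contrapT => /not_orP[/contrapT Sx /contrapT Sy];
    apply/nxy/SM.
Qed.

Lemma minimal_prime_prime P : minimal_primes H P -> prime_s_ideal P.
Proof. by case. Qed.

(** The elements that divide no s y^n with s outside P form a prime ideal inside
    P that misses y; by minimality it contains only zero. *)
Lemma minimal_prime_divides P x y : minimal_primes H P -> ~ zeros x -> P y ->
  exists s n k, ~ P s /\ s * y ^+ n = x * k.
Proof.
move=> [Pp zP minP] nx Py.
pose S := [set d | exists s n k, ~ P s /\ s * y ^+ n = d * k].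
have [zy|ny] := pselect (zeros y).
  exists 1, 1%N, y; split; first exact: prime_not1.
  by rewrite expg1 mul1g mulgC zy.
apply: contrapT => nSx.
have Sp : prime_s_ideal (~` S).
  apply: prime_setC.
  - by exists 1, 0%N, 1; split; [exact: prime_not1|rewrite expg0 !mulg1].
  - move=> a b; split.
      move=> [s [n [k [Ps e]]]]; split.
        by exists s, n, (b * k); rewrite mulgA.
      by exists s, n, (a * k); rewrite e; split=> //; comm_mul.
    move=> [[s [n [k [Ps e]]]] [t [m [l [Pt f]]]]].
    exists (s * t), (n + m)%N, (k * l); split; first exact: prime_notinM.
    by rewrite expgnDr mulgACA e f; comm_mul.
  - move=> d [s [n [k [Ps e]]]] zd; have : zeros (d * k) by exact: zerosM.
    rewrite -e; apply: mul_nonzero; first exact: prime_notin Ps.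
    exact: nonzero_exp.
have SP : ~` S `<=` P.
  move=> d nSd; apply: contrapT => nPd; apply: nSd.
  by exists d, 0%N, 1; rewrite expg0.
have zS : zeros `<` ~` S.
  split; first exact: prime_zeros Sp.
  by move=> h; apply: nx; exact: h.
have : (~` S) y by rewrite (minP _ Sp zS SP).
apply; exists 1, 1%N, 1; split; first exact: prime_not1.
by rewrite expg1 mulg1 mul1g.
Qed.

Lemma minimal_prime_nonzero P : minimal_primes H P ->
  exists x, P x /\ ~ zeros x.
Proof. by move=> [_ [_ /existsNP[x /not_implyP[Px nx]]] _]; exists x. Qed.

End SIdealTheory.

(** * Principal ideals and radical factoriality *)

Section PrincipalIdeals.
Variable M : comMonoidType.
Implicit Types (X : set M) (x y z : M).

Lemma principal_mem x : smul x (@setT M) x.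
Proof. by exists 1; rewrite ?mulg1. Qed.

Lemma setmul_principal x y :
  setmul (smul x setT) (smul y setT) = smul (x * y) (@setT M).
Proof.
apply/seteqP; split.
  move=> _ [_ [a _ <-] [_ [b _ <-] <-]]; exists (a * b) => //; comm_mul.
move=> _ [a _ <-]; exists x; first exact: principal_mem.
by exists (y * a); [exists a|rewrite mulgA].
Qed.

Lemma principal_smul x : principal (smul x (@setT M)).
Proof.
exists [set x]; split; first by move=> ? ? -> ->.
apply/seteqP; split=> [_ [a _ <-]|z [[_ -> [a _ <-]]|zz]].
- by left; exists x => //; exists a.
- by exists a.
- by exists z; rewrite // mulgC.
Qed.

(** When the generating set is empty, the only element of X is zero, which
    generates X. *)
Lemma principal_nonempty X : principal X -> (exists x, X x) ->
  exists y, X = smul y setT.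
Proof.
move=> [A [A1 XE]] [x]; rewrite {1}XE => Xx.
have [[a Aa]|nA] := pselect (exists a, A a).
  exists a; rewrite XE; apply/seteqP; split.
    move=> z [[b Ab [c _ <-]]|zz]; first by rewrite (A1 _ _ Ab Aa); exists c.
    by exists z; rewrite // mulgC.
  by move=> _ [c _ <-]; left; exists a => //; exists c.
have {}zx : zeros x by case: Xx => // -[b Ab]; case: nA; exists b.
exists x; rewrite XE; apply/seteqP; split.
  move=> z [[b Ab]|zz]; first by case: nA; exists b.
  by exists z; rewrite // mulgC.
by move=> _ [c _ <-]; right; rewrite zx.
Qed.

Lemma subset_rad X : X `<=` rad X.
Proof. by move=> x Xx; exists 1%N; rewrite expg1. Qed.

(** Elements suffice: a principal ideal without elements occurs only when there
    is no zero, and it is radical, hence its own factorization. *)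
Lemma radical_factorialP : radical_factorial M <->
  forall x, exists l : seq M, {in l, forall y, radical (smul y setT)} /\
    smul x setT = smul (foldr *%g 1 l) setT.
Proof.
have prodE (l : seq M) : foldr setmul setT [seq smul y setT | y <- l] =
    smul (foldr *%g 1 l) setT.
  elim: l => [|y l IHl] /=; last by rewrite IHl setmul_principal.
  by apply/seteqP; split=> // x _; exists x; rewrite ?mul1g.
split=> [RF x|RF X pX].
  have [s [sP xE]] := RF _ (principal_smul x).
  have : exists y, foldr setmul setT s y.
    by exists x; rewrite -xE; exact: principal_mem.
  rewrite xE; elim: s sP {xE} => [_ _|Y s IHs sP [_ [y Yy [z sz _]]]].
    by exists [::]; split=> //; rewrite -prodE.
  have [pY radY] := sP Y (mem_head _ _).
  have [|l [lP lE]] := IHs _ (ex_intro _ z sz).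
    by move=> Z Zs; apply: sP; rewrite inE Zs orbT.
  have [a YE] := principal_nonempty pY (ex_intro _ y Yy).
  exists (a :: l); split; last by rewrite /= lE YE setmul_principal.
  by move=> b; rewrite inE => /orP[/eqP ->|/lP//]; rewrite -YE.
have [nX|XE] := pselect (exists x, X x).
  have [y ->] := principal_nonempty pX nX; have [l [lP yE]] := RF y.
  exists [seq smul z setT | z <- l]; split; last by rewrite prodE.
  by move=> _ /mapP[z zl ->]; split; [exact: principal_smul|exact: lP].
have {}XE : X = set0 by apply/seteqP; split=> // x Xx; case: XE; exists x.
exists [:: X]; split.
  move=> Y; rewrite inE => /eqP ->; split=> //; rewrite XE.
  by apply/seteqP; split=> // x [n []].
by rewrite XE /=; apply/seteqP; split=> // x [].
Qed.

End PrincipalIdeals.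

(** * Powers of ideals *)

Section Powers.
Variable H : cancelMonoidType.
Implicit Types (X Y I P : set H) (x y z s : H).

Lemma setpowM X n x y : setpow X n x -> setpow X n (x * y).
Proof.
elim: n x => [//|n IHn] x [a Xa [b Xb <-]]; exists a => //.
by exists (b * y); [exact: IHn|rewrite mulgA].
Qed.

Lemma setpow_exp X n x : X x -> setpow X n (x ^+ n).
Proof.
move=> Xx; elim: n => // n IHn; rewrite expgS.
by exists x => //; exists (x ^+ n).
Qed.

(** Pigeonhole: among n + m factors, n lie in X or m lie in Y. *)
Lemma setpowU X Y n m :
  setpow (X `|` Y) (n + m) `<=` setpow X n `|` setpow Y m.
Proof.
elim: n m => [|n IHn] m; first by left.
elim: m => [|m IHm]; first by right.
rewrite addSn => _ [c XYc [z hz <-]]; case: XYc => [Xc|Yc].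
  case: (IHn _ _ hz) => [hz'|hz']; first by left; exists c => //; exists z.
  by right; rewrite mulgC; exact: setpowM.
have {}hz : setpow (X `|` Y) (n.+1 + m) z by rewrite addSn -addnS.
case: (IHm _ hz) => [hz'|hz']; last by right; exists c => //; exists z.
by left; rewrite mulgC; exact: setpowM.
Qed.

(** The missing powers of s and y are supplied by the (n+1)-st power. *)
Lemma rad_exp I s y n : (forall x z, I x -> I (x * z)) ->
  I (s * y ^+ n) -> rad I (s * y).
Proof.
move=> IM Isy; exists n.+1; split=> //; rewrite expgMC expgS [y ^+ _]expgS.
rewrite (_ : s * s ^+ n * _ = s * y ^+ n * (s ^+ n * y)); first exact: IM.
by comm_mul.
Qed.

(** The radical of the localization of I at S, contracted to H. *)
Definition local_rad (S I : set H) : set H :=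
  [set y | exists s n, S s /\ I (s * y ^+ n)].

(** A finite set in the radical is nilpotent: by induction on the generators,
    [setpowU] adds the exponents and the denominators multiply. *)
Lemma setpow_local_rad S I (l : seq H) : S 1 ->
  (forall s t, S s -> S t -> S (s * t)) -> (forall x y, I x -> I (x * y)) ->
  [set` l] `<=` local_rad S I ->
  exists s n, S s /\ smul s (setpow [set` l] n) `<=` I.
Proof.
move=> S1 SM IM; elim: l => [_|e l IHl lS].
  by exists 1, 1%N; split=> // y [z [a]].
have [|s [n [Ss sn]]] := IHl.
  by move=> z zl; apply: lS; rewrite /= inE; apply/orP; right.
have [|t [m [St te]]] := lS e; first by rewrite /= inE eqxx.
exists (s * t), (m + n)%N; split; first exact: SM.
have -> : [set` e :: l] = [set e] `|` [set` l].
  apply/seteqP; split=> z /=; rewrite inE.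
    by move=> /orP[/eqP ->|]; [left|right].
  by move=> [->|->]; rewrite ?eqxx ?orbT.
move=> _ [z /setpowU[] hz <-]; last first.
  by rewrite mulgAC; apply: IM; apply: sn; exists z.
have {hz}[w ->] : exists w, z = e ^+ m * w.
  elim: m z hz {te} => [|m IHm] z; first by exists z; rewrite expg0 mul1g.
  by move=> [_ -> [b /IHm[w ->] <-]]; exists w; rewrite expgS mulgA.
rewrite (_ : s * t * _ = t * e ^+ m * (s * w)); [exact: IM|comm_mul].
Qed.

End Powers.

(** * Closures and quotients *)

Section IdealSystems.
Variables (H : cancelMonoidType) (r : finitary_ideal_system H).
Implicit Types (X Y Z I J K P Q : set H) (x y z s : H) (u : frac H).

Lemma r_idealM I x y : r_ideal r I -> I x -> I (x * y).
Proof.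
by move=> /r_ideal_mulT IE Ix; rewrite -IE; exists x => //; exists y.
Qed.

Lemma r_ideal_s_ideal I : r_ideal r I -> s_ideal I.
Proof.
move=> rI; apply: s_idealP => [x y|]; first exact: r_idealM.
by move=> x zx; rewrite -rI; apply: closure_sub; right.
Qed.

(** Ideal systems commute with multiplication by elements of H; clearing
    denominators extends this to multipliers in the quotient monoid. *)
Lemma closure_frac u Z K :
  (forall z, Z z -> exists2 h, r K h & u * z%:F = h%:F) ->
  forall z, r Z z -> exists2 h, r K h & u * z%:F = h%:F.
Proof.
move=> uZ z rZz; have [c [d [nd e]]] := frac_denom u.
have clear a h : u * a%:F = h%:F <-> c * a = d * h.
  split=> [ua|/(congr1 frac_inj)].
    by apply: frac_inj_injective; rewrite !frac_injM -ua -e; comm_mul.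
  rewrite !frac_injM -e => ca; apply: (frac_cancel nd).
  by rewrite -ca; comm_mul.
have : smul c (r Z) (c * z) by exists z.
rewrite closure_smul => /(@closure_le _ r _ (smul d K)).
rewrite -closure_smul; case=> [_ [a Za <-]|h rKh hc].
  by have [h rKh /clear ->] := uZ _ Za; exists h.
by exists h => //; apply/clear.
Qed.

Lemma r_ideal_frac u Z K : r_ideal r K ->
  (forall z, Z z -> exists2 h, K h & u * z%:F = h%:F) ->
  forall z, r Z z -> exists2 h, K h & u * z%:F = h%:F.
Proof. by move=> rK uZ z; have := @closure_frac u Z K; rewrite rK; apply. Qed.

Lemma r_ideal_mul x Z K : r_ideal r K -> (forall z, Z z -> K (x * z)) ->
  forall z, r Z z -> K (x * z).
Proof.
move=> rK xZ z /(r_ideal_frac (u := x%:F) rK)[].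
  by move=> a /xZ Kxa; exists (x * a); rewrite ?frac_injM.
by move=> h Kh /esym; rewrite -frac_injM => /frac_inj_injective <-.
Qed.

Lemma inv_setP I u :
  inv_set (frac_inj @` I) u <-> forall x, I x -> exists h, u * x%:F = h%:F.
Proof.
split=> [uI x Ix|uI _ [_ [x Ix <-] <-]].
  by have [|h _ <-] := uI (u * x%:F); [exists x%:F => //; exists x|exists h].
by have [h ->] := uI x Ix; exists h.
Qed.

Lemma mul_invP I y : mul_inv I y <->
  exists x u, [/\ I x, inv_set (frac_inj @` I) u & x%:F * u = y%:F].
Proof.
split=> [[_ [x Ix <-] [u uI e]]|[x [u [Ix uI e]]]]; first by exists x, u.
by exists x%:F; [exists x|exists u].
Qed.

Lemma mul_inv_mul I x u : I x -> inv_set (frac_inj @` I) u ->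
  exists2 h, mul_inv I h & x%:F * u = h%:F.
Proof.
move=> Ix uI; have [h hE] := (inv_setP I u).1 uI x Ix.
by exists h; [apply/mul_invP; exists x, u|]; rewrite mulgC.
Qed.

(** Since 1 lies in the closure of I I^-1, this tests membership in K after
    multiplication by I I^-1. *)
Lemma invertible_mem I K x : r_invertible r I -> r_ideal r K ->
  (forall b u h, I b -> inv_set (frac_inj @` I) u -> b%:F * u = h%:F ->
     K (x * h)) ->
  K x.
Proof.
move=> iI rK h; rewrite -[x]mulg1; apply: (@r_ideal_mul _ (mul_inv I)) => //.
  by move=> z /mul_invP[b [u [Ib uI e]]]; exact: h e.
by rewrite iI.
Qed.

Lemma r_mul_mem X Y x y : X x -> Y y -> r_mul r X Y (x * y).
Proof. by move=> Xx Yy; apply: closure_id_sub; exists x => //; exists y. Qed.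

Lemma r_mul_subl X Y : r_ideal r X -> r_mul r X Y `<=` X.
Proof.
move=> rX; rewrite -{2}rX; apply: closure_le => _ [x Xx [y _ <-]].
by rewrite rX; exact: r_idealM.
Qed.

Lemma r_mulC X Y : r_mul r X Y = r_mul r Y X.
Proof. by rewrite /r_mul setmulC. Qed.

(** Cancelling I: the elements of I^-1 carry (IJ)_r into J. *)
Lemma r_mul_div I J x u : r_ideal r J -> r_mul r I J x ->
  inv_set (frac_inj @` I) u -> exists2 h, J h & u * x%:F = h%:F.
Proof.
move=> rJ IJx /inv_setP uI; apply: (r_ideal_frac rJ _ IJx).
move=> _ [a Ia [b Jb <-]]; have [h e] := uI a Ia; exists (b * h).
  exact: r_idealM.
by rewrite !frac_injM mulgA e mulgC.
Qed.

(** (IJ)(IJ)^-1 is contained in JJ^-1, because I(IJ)^-1 is contained in J^-1. *)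
Lemma invertible_factor I J : r_ideal r J ->
  invertible_r_ideals r (r_mul r I J) -> invertible_r_ideals r J.
Proof.
move=> rJ [rIJ iIJ]; split=> //; apply/seteqP; split=> // x _.
apply: (invertible_mem iIJ) (closure_idem _ _) _ => z u h IJz uIJ zu.
suff hJ : r (mul_inv J) h.
  by rewrite mulgC; apply: r_idealM hJ; exact: closure_idem.
rewrite mulgC in zu.
have [|k rk] :=
    closure_frac (u := u) (Z := setmul I J) (K := mul_inv J) _ IJz; last first.
  by rewrite zu => /frac_inj_injective ->.
move=> _ [a Ia [b Jb <-]].
have [|k kJ e] := @mul_inv_mul J b (u * a%:F) Jb.
  apply/inv_setP => c Jc; have [|l e] := (inv_setP _ _).1 uIJ (a * c).
    exact: r_mul_mem.
  by exists l; rewrite -e frac_injM mulgA.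
exists k; first exact: closure_id_sub.
by rewrite -e frac_injM; comm_mul.
Qed.

(** The cofactor is (I K^-1)_r. *)
Lemma invertible_divides I K : invertible_r_ideals r I ->
  invertible_r_ideals r K -> I `<=` K ->
  exists2 J, invertible_r_ideals r J & I = r_mul r K J.
Proof.
move=> [rI iI] [rK iK] IK.
pose J0 := [set h | exists x u,
  [/\ I x, inv_set (frac_inj @` K) u & x%:F * u = h%:F]].
have IE : I = r_mul r K (r J0).
  apply/seteqP; split=> [x Ix|x].
    apply: (invertible_mem iK) (closure_idem _ _) _ => b u h Kb uK e.
    have [k xu] := (inv_setP _ _).1 uK x (IK x Ix).
    rewrite (_ : x * h = b * k).
      apply: r_mul_mem => //; apply: closure_id_sub; exists x, u.
      by rewrite mulgC xu.
    by apply: frac_inj_injective; rewrite !frac_injM -e -xu; comm_mul.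
  rewrite /r_mul closure_mulr -[X in _ -> X _]rI; apply: closure_le.
  move=> _ [b Kb [h [y [u [Iy uK e]]] <-]]; rewrite rI.
  have [k ub] := (inv_setP _ _).1 uK b Kb.
  rewrite (_ : b * h = y * k); first exact: r_idealM.
  by apply: frac_inj_injective; rewrite !frac_injM -e -ub; comm_mul.
exists (r J0) => //; apply: (@invertible_factor K); first exact: closure_idem.
by rewrite -IE.
Qed.

(** Because (xH)_r = x H_r and H_r = H. *)
Lemma principal_r_ideal x : r_ideal r (smul x setT).
Proof. by rewrite /r_ideal -closure_smul closureT. Qed.

Lemma r_mul_principal x y :
  r_mul r (smul x setT) (smul y setT) = smul (x * y) setT.
Proof. by rewrite /r_mul setmul_principal principal_r_ideal. Qed.

Lemma principal_invertible x : ~ zeros x ->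
  invertible_r_ideals r (smul x setT).
Proof.
move=> nx; split; first exact: principal_r_ideal.
apply/seteqP; split=> // y _; apply: closure_id_sub.
have [w xw] := frac_inj_inv nx.
apply/mul_invP; exists (x * y), w; split; first by exists y.
  apply/inv_setP => _ [a _ <-]; exists a.
  by rewrite frac_injM mulgA [w * _]mulgC xw mul1g.
by rewrite frac_injM mulgAC xw mul1g.
Qed.

(** * Radicals *)

Lemma closure_exp X x n : r X x -> r (setpow X n) (x ^+ n).
Proof.
move=> rXx; elim: n => [|n IHn]; first exact: closure_id_sub.
rewrite expgS /= -closure_mull -closure_mulr; apply: closure_id_sub.
by exists x => //; exists (x ^+ n).
Qed.

Lemma common_denominator (S I : set H) (l : seq H) : S 1 ->
  (forall s t, S s -> S t -> S (s * t)) -> (forall x y, I x -> I (x * y)) ->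
  {in l, forall e, exists2 s, S s & I (s * e)} ->
  exists2 s, S s & {in l, forall e, I (s * e)}.
Proof.
move=> S1 SM IM; elim: l => [_|e l IHl lS]; first by exists 1.
have [|s Ss sl] := IHl; first by move=> d dl; apply: lS; rewrite inE dl orbT.
have [t St te] := lS e (mem_head _ _); exists (t * s); first exact: SM.
move=> d; rewrite inE => /orP[/eqP ->|/sl sd].
  by rewrite mulgAC; exact: IM.
by rewrite -mulgA mulgC; exact: IM.
Qed.

(** Finitarity reduces this to finitely many generators, which admit a common
    denominator and a common exponent. *)
Lemma local_rad_r_ideal (S I : set H) : S 1 ->
  (forall s t, S s -> S t -> S (s * t)) -> r_ideal r I ->
  r_ideal r (local_rad S I).
Proof.
move=> S1 SM rI; apply/seteqP; split; last exact: closure_id_sub.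
move=> y; rewrite closure_finitary => -[E [EI /finite_seqP[l El]] Ey].
have [||s [n [Ss sn]]] := @setpow_local_rad _ S I l S1 SM.
- by move=> a b; exact: r_idealM.
- by rewrite -El.
exists s, n; split=> //; apply: (@r_ideal_mul s (setpow E n)) => //.
  by move=> z Ez; apply: sn; exists z; rewrite -?El.
exact: closure_exp.
Qed.

(** The inclusion of P in the local radical of I says that P is minimal over I;
    then P is equal to that local radical. *)
Lemma local_rad_prime_r_ideal P I : prime_s_ideal P -> r_ideal r I ->
  I `<=` P -> P `<=` local_rad (~` P) I -> r_ideal r P.
Proof.
move=> Pp rI IP PI; suff -> : P = local_rad (~` P) I.
  apply: local_rad_r_ideal => //; first exact: prime_not1.
  by move=> s t; exact: prime_notinM.
apply/seteqP; split=> // y [s [n [Ps /IP]]].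
case: (Pp) => _ _ pr /pr[/Ps//|]; exact: prime_exp.
Qed.

(** P is minimal over xH for each nonzero x in P. *)
Lemma minimal_prime_r_ideal P : minimal_primes H P -> r_ideal r P.
Proof.
move=> mP; have Pp := minimal_prime_prime mP.
have [x [Px nx]] := minimal_prime_nonzero mP.
apply: (@local_rad_prime_r_ideal P (smul x setT)) => //.
- exact: principal_r_ideal.
- by move=> _ [k _ <-]; exact: primeMr.
- move=> y Py; have [s [n [k [Ps e]]]] := minimal_prime_divides mP nx Py.
  by exists s, n; rewrite e; split=> //; exists k.
Qed.

(** Otherwise I I^-1, and with it 1, would lie in the r-ideal P. *)
Lemma prime_invertible_notin P I : prime_s_ideal P -> r_ideal r P ->
  r_invertible r I ->
  exists b u h, [/\ I b, inv_set (frac_inj @` I) u, b%:F * u = h%:F & ~ P h].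
Proof.
move=> Pp rP iI; apply: contrapT => noh; apply: (prime_not1 Pp).
apply: (invertible_mem iI rP) => b u h Ib uI e; rewrite mul1g.
by apply: contrapT => Ph; apply: noh; exists b, u, h.
Qed.

(** The exponent is uniform because an invertible ideal is the closure of a
    finite set. *)
Lemma invertible_rad_exp I K : invertible_r_ideals r K -> r_ideal r I ->
  K `<=` rad I -> exists n, forall x, K x -> I (x ^+ n).
Proof.
move=> [rK iK] rI KI.
have : r (mul_inv K) 1 by rewrite iK.
rewrite closure_finitary => -[F [FK /finite_seqP[l Fl]] F1].
(* The elements g f, for f in F, generate K. *)
have [g gP] : exists g : H -> H, forall f, F f ->
    K (g f) /\ exists2 u, inv_set (frac_inj @` K) u & (g f)%:F * u = f%:F.
  have /choice : forall f, exists b, F f ->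
      K b /\ exists2 u, inv_set (frac_inj @` K) u & b%:F * u = f%:F.
    move=> f; have [Ff|] := pselect (F f); last by exists f.
    have /mul_invP[b [u [Kb uK e]]] := FK f Ff.
    by exists b => _; split=> //; exists u.
  by move=> [g gP]; exists g.
have [||||s [n [-> sn]]] := @setpow_local_rad _ [set 1] I (map g l).
- by [].
- by move=> s t -> ->; rewrite mul1g.
- by move=> a b; exact: r_idealM.
- move=> _ /mapP[f fl ->]; have [|Kgf _] := gP f; first by rewrite Fl.
  by have [n [_ hn]] := KI _ Kgf; exists 1, n; rewrite mul1g.
exists n => x Kx; rewrite -[x ^+ n]mul1g.
apply: (@r_ideal_mul 1 (setpow [set` map g l] n)) => //.
  by move=> z hz; apply: sn; exists z.
apply: closure_exp; rewrite -[x]mulg1.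
apply: (@r_ideal_mul x F) => //; first exact: closure_idem.
move=> f Ff; have [Kg [u /inv_setP uK e]] := gP f Ff.
have [h xh] := uK x Kx; apply: (closure_sub); left; exists (g f).
  by apply/mapP; exists f => //; move: Ff; rewrite Fl.
exists h => //; apply: frac_inj_injective.
by rewrite !frac_injM -e -xh; comm_mul.
Qed.

End IdealSystems.

(** * Discrete valuation monoids *)

Section Uniformizers.
Variable H : cancelMonoidType.
Implicit Types (X P : set H) (x y z s : H).

(** That a generates the maximal ideal of H_P, expressed inside H. *)
Definition uniformizer P a : Prop :=
  P a /\ forall y, P y -> exists s k, ~ P s /\ s * y = a * k.

Lemma uniformizer_exp P a y n : prime_s_ideal P -> uniformizer P a -> P y ->
  exists s k, ~ P s /\ s * y ^+ n = a ^+ n * k.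
Proof.
move=> Pp [_ aP] Py; have [s [k [Ps e]]] := aP y Py.
exists (s ^+ n), (k ^+ n); split; first exact: prime_notin_exp.
by rewrite -!expgMC e.
Qed.

Section AtPrime.
Variables (P : set H) (Pprime : prime_s_ideal P).
Local Notation L := (localization Pprime).

Definition to_local (x : H) : L :=
  exist _ x%:F (mem_set (local_set_inj Pprime x)).

Lemma to_localM x y : to_local (x * y) = to_local x * to_local y.
Proof. by apply: val_inj; rewrite valM /= frac_injM. Qed.

Lemma to_local_inj : injective to_local.
Proof. by move=> x y /(congr1 val) /frac_inj_injective. Qed.

Lemma to_local_inv s : ~ P s -> exists w, to_local s * w = 1.
Proof.
move=> Ps; have [w sw] := frac_inj_inv (prime_notin Pprime Ps).
have lw : local_set P w by exists s, 1; rewrite mulgC sw.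
by exists (exist _ w (mem_set lw)); apply: val_inj; rewrite valM /= sw.
Qed.

Lemma to_local_denom (x : L) : exists s h, ~ P s /\ x * to_local s = to_local h.
Proof.
have /set_mem[s [h [Ps e]]] := valP x.
by exists s, h; split=> //; apply: val_inj; rewrite valM.
Qed.

Lemma to_local_zeros x : zeros (to_local x) <-> zeros x.
Proof.
split=> [zx y|zx y]; first by apply: to_local_inj; rewrite to_localM zx.
have [s [h [Ps e]]] := to_local_denom y; have [w sw] := to_local_inv Ps.
have zw : to_local x * w = to_local x.
  by rewrite -{1}(zx s) to_localM -mulgA sw mulg1.
have -> : y = to_local h * w by rewrite -e -mulgA sw mulg1.
by rewrite mulgA -to_localM zx.
Qed.

Lemma to_local_unit x : (exists w, to_local x * w = 1) -> ~ P x.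
Proof.
move=> [w xw] Px; have [t [h [Pt e]]] := to_local_denom w.
apply: Pt; rewrite (_ : t = x * h); first exact: primeMr.
by apply: to_local_inj; rewrite to_localM -e mulgA xw mul1g.
Qed.

(** The non-units of H_P form an s-ideal, so they have a single generator. *)
Lemma DVM_uniformizer : minimal_primes H P -> DVM L ->
  exists a, uniformizer P a.
Proof.
move=> mP [_ dvm]; pose M : set L := [set z | ~ exists w, z * w = 1].
have [|A [A1 ME]] := dvm M.
  apply: s_idealP => [x y nx [w e]|z zz [w zw]].
    by apply: nx; exists (y * w); rewrite mulgA.
  by apply: (@one_nonzero L); rewrite -zw; exact: zerosM.
have Pnonunit x : P x -> M (to_local x) by move=> Px /to_local_unit.
have [x [Px nx]] := minimal_prime_nonzero mP.
have := Pnonunit x Px; rewrite {1}ME => -[[al Aal _]|/to_local_zeros//].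
have [s [a [Ps sa]]] := to_local_denom al.
exists a; split.
  apply: contrapT => /to_local_inv[w aw].
  have : M al by rewrite ME; left; exists al => //; exists 1; rewrite ?mulg1.
  by apply; exists (to_local s * w); rewrite mulgA sa.
move=> y Py; have := Pnonunit y Py; rewrite {1}ME => -[[al' Aal' [b _ yE]]|].
  have [t [k [Pt tk]]] := to_local_denom b.
  exists (s * t), k; split; first exact: prime_notinM.
  apply: to_local_inj; rewrite !to_localM -yE (A1 _ _ Aal' Aal) -sa -tk.
  by comm_mul.
move=> /to_local_zeros zy; exists 1, y; split; first exact: prime_not1 Pprime.
by rewrite mul1g [RHS]mulgC zy.
Qed.

Lemma uniformizer_nonzero a : minimal_primes H P -> uniformizer P a ->
  ~ zeros a.
Proof.
move=> mP [Pa aP] za; have [x [Px nx]] := minimal_prime_nonzero mP.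
have [s [k [Ps e]]] := aP x Px.
have : ~ zeros (s * x) by apply: mul_nonzero nx; exact: prime_notin Ps.
by rewrite e; apply; exact: zerosM.
Qed.

(** By minimality of P, h divides a power of a locally, say the n-th; either h
    is a local unit or a can be cancelled, which lowers n. *)
Lemma uniformizer_valuation a h : minimal_primes H P -> uniformizer P a ->
  ~ zeros h -> exists n s t, [/\ ~ P s, ~ P t & s * h = t * a ^+ n].
Proof.
move=> mP aU nh; have na := uniformizer_nonzero mP aU; case: aU => Pa aP.
have [s [n [k [Ps e]]]] := minimal_prime_divides mP nh Pa.
have P1 := prime_not1 Pprime.
elim: n s h k nh Ps e => [|n IHn] s h k nh Ps e.
  exists 0%N, 1, h; split=> //; last by rewrite expg0 mulg1 mul1g.
  by move=> Ph; apply: Ps; rewrite -[s]mulg1 -(expg0 a) e; exact: primeMr.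
have [Ph|Ph] := pselect (P h); last first.
  by exists 0%N, 1, h; split=> //; rewrite expg0 mulg1 mul1g.
have [t [h' [Pt th]]] := aP h Ph.
have nah' : ~ zeros (a * h').
  by rewrite -th; apply: mul_nonzero nh; exact: prime_notin Pt.
have [|||m [s1 [t1 [Ps1 Pt1 e1]]]] := IHn (t * s) h' k.
- by rewrite mulgC in nah'; exact: nonzeroM_l nah'.
- exact: prime_notinM.
- apply: (nonzero_cancel na); rewrite [RHS]mulgA -th -[RHS]mulgA -e expgS.
  by comm_mul.
exists m.+1, (s1 * t), t1; split=> //; first exact: prime_notinM.
by rewrite -mulgA th mulgCA e1 expgS; comm_mul.
Qed.

(** A nonzero s-ideal of H_P is generated by the least power of a in it. *)
Lemma uniformizer_DVM a : minimal_primes H P -> uniformizer P a -> DVM L.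
Proof.
move=> mP aU; have na := uniformizer_nonzero mP aU; split.
  move=> rE; have nA : ~ zeros (to_local a) by rewrite to_local_zeros.
  have [y ay] := frac_inj_inv nA.
  have [b _ be] : range (@frac_inj L) y by rewrite rE.
  apply: (@to_local_unit a); last by case: aU.
  by exists b; apply: frac_inj_injective; rewrite frac_injM be.
have val_a (x : L) : ~ zeros x ->
    exists n u v, u * v = 1 /\ x = to_local a ^+ n * u.
  have aX n : to_local (a ^+ n) = to_local a ^+ n.
    by elim: n => [|n IHn]; [exact: val_inj|rewrite !expgS to_localM IHn].
  move=> nx; have [t [h [Pt e]]] := to_local_denom x.
  have [w tw] := to_local_inv Pt.
  have nh : ~ zeros h.
    move=> /to_local_zeros zh; apply: nx.
    by rewrite -[x]mulg1 -tw mulgA e; exact: zerosM.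
  have [n [s1 [t1 [Ps1 Pt1 e1]]]] := uniformizer_valuation mP aU nh.
  have [v1 sv] := to_local_inv Ps1; have [w1 tw1] := to_local_inv Pt1.
  exists n, (to_local t1 * (v1 * w)), (w1 * (to_local s1 * to_local t)); split.
    transitivity ((to_local t1 * w1) *
        ((to_local s1 * v1) * (to_local t * w))); first by comm_mul.
    by rewrite tw1 sv tw !mulg1.
  have /(congr1 (fun z => to_local z * (v1 * w))) := e1.
  rewrite !to_localM -e aX => e2.
  rewrite mulgA [_ ^+ n * _]mulgC -e2.
  rewrite (_ : _ * (v1 * w) = x * ((to_local s1 * v1) * (to_local t * w))).
    by rewrite tw sv !mulg1.
  by comm_mul.
move=> X sX.
have [[x [Xx nx]]|nX] := pselect (exists x : L, X x /\ ~ zeros x); last first.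
  exists set0; split=> //; apply/seteqP; split=> z.
    by move=> Xz; right; apply: contrapT => nz; apply: nX; exists z.
  by move=> [[]//|]; exact: s_ideal_zeros.
have mem n u v : u * v = 1 -> X (to_local a ^+ n * u) -> X (to_local a ^+ n).
  by move=> uv Xa; rewrite -[_ ^+ n]mulg1 -uv mulgA; exact: s_idealM.
have exn : exists n, `[< X (to_local a ^+ n) >].
  have [n [u [v [uv xE]]]] := val_a x nx.
  by exists n; apply/asboolP; apply: (mem n u v) => //; rewrite -xE.
case: (ex_minnP exn) => m /asboolP Xm minm.
exists [set to_local a ^+ m]; split; first by move=> ? ? -> ->.
apply/seteqP; split=> [z Xz|z [[_ -> [b _ <-]]|]]; last 2 first.
- exact: s_idealM.
- exact: s_ideal_zeros.
have [|nz] := pselect (zeros z); first by right.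
have [n [u [v [uv zE]]]] := val_a z nz; left.
exists (to_local a ^+ m) => //; exists (to_local a ^+ (n - m) * u) => //.
rewrite mulgA -expgnDr subnKC -?zE //; apply: minm; apply/asboolP.
by apply: (mem n u v) => //; rewrite -zE.
Qed.

End AtPrime.
End Uniformizers.

(** * Products of ideals *)

Lemma mem_cons (T : eqType) (x y : T) (s : seq T) : x \in s -> x \in y :: s.
Proof. by rewrite inE orbC => ->. Qed.

Section Products.
Variables (H : cancelMonoidType) (r : finitary_ideal_system H).
Implicit Types (X Y I J K P Q : set H) (x y z s : H) (l : seq (set H)).

Definition r_prod l : set H := foldr (r_mul r) setT l.

Lemma r_prod_r_ideal l : r_ideal r (r_prod l).
Proof. by case: l => [|J l]; [exact: closureT|exact: closure_idem]. Qed.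

Lemma r_prod_sub l J : {in l, forall K, r_ideal r K} -> J \in l ->
  r_prod l `<=` J.
Proof.
elim: l => [//|K l IHl] lr; rewrite inE => /orP[/eqP ->|Jl].
  by apply: r_mul_subl; apply: lr; exact: mem_head.
apply: subset_trans (IHl _ Jl); last first.
  by move=> L Ll; apply: lr; exact: mem_cons.
by rewrite /= r_mulC; apply: r_mul_subl; exact: r_prod_r_ideal.
Qed.

Lemma r_prod_exp l x : (forall J, J \in l -> J x) -> r_prod l (x ^+ size l).
Proof.
elim: l => [//|J l IHl] lx; rewrite expgS; apply: r_mul_mem.
  by apply: lx; exact: mem_head.
by apply: IHl => K Kl; apply: lx; exact: mem_cons.
Qed.

Lemma r_prod_invertible l : {in l, forall J, r_ideal r J} ->
  invertible_r_ideals r (r_prod l) -> {in l, forall J, invertible_r_ideals r J}.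
Proof.
elim: l => [//|K l IHl] lr lI J; rewrite inE => /orP[/eqP ->|].
  move: lI; rewrite /= r_mulC; apply: invertible_factor.
  by apply: lr; exact: mem_head.
apply: IHl; first by move=> L Ll; apply: lr; exact: mem_cons.
by move: lI; apply: invertible_factor; exact: r_prod_r_ideal.
Qed.

Lemma invertible_r_prod l : {in l, forall J, invertible_r_ideals r J} ->
  invertible_r_ideals r (r_prod l).
Proof.
elim: l => [_|J l IHl lI]; first exact: invertibleT.
apply: invertibleM; first by apply: lI; exact: mem_head.
by apply: IHl => K Kl; apply: lI; exact: mem_cons.
Qed.

Lemma r_prod_prime l P : prime_s_ideal P -> r_prod l `<=` P ->
  exists2 J, J \in l & J `<=` P.
Proof.
move=> Pp; elim: l => [/(_ 1 I)/(prime_not1 Pp)//|J l IHl] lP.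
have [JP|/existsNP[x /not_implyP[Jx nPx]]] := pselect (J `<=` P).
  by exists J => //; exact: mem_head.
have [|K Kl KP] := IHl; last by exists K => //; exact: mem_cons.
move=> y ly; have /lP : r_prod (J :: l) (x * y) by exact: r_mul_mem.
by case: (Pp) => _ _ pr /pr[].
Qed.

Definition below P : pred (set H) := fun J => `[< J `<=` P >].

Lemma count_belowE l P : uniq l -> count_below [set` l] P = count (below P) l.
Proof.
move=> ul; rewrite /count_below.
rewrite (_ : [set J | _] = [set` [fset J in filter (below P) l]%fset]).
  by rewrite set_fsetK card_fseq undup_id ?size_filter // filter_uniq.
apply/seteqP; split=> J /=; rewrite in_fset mem_filter.
  by move=> [-> JP]; rewrite andbT; apply/asboolP.
by move=> /andP[/asboolP].
Qed.

Lemma r_prod_setpow l P : {in l, forall J, r_ideal r J} ->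
  r_prod l `<=` r (setpow P (count (below P) l)).
Proof.
elim: l => [_|J l IHl lr]; first by move=> x _; exact: closure_id_sub.
have {}IHl := IHl (fun K Kl => lr K (mem_cons J Kl)).
rewrite /= /below; case: asboolP => [JP|_] /=.
  rewrite -closure_mulr; apply: closure_mono; exact: setmul_mono.
apply: subset_trans IHl; rewrite r_mulC; apply: r_mul_subl.
exact: r_prod_r_ideal.
Qed.

Lemma setpow_anti P m n : (m <= n)%N -> setpow P n `<=` setpow P m.
Proof.
move=> /subnKC <-; elim: (n - m)%N => [|k IHk]; first by rewrite addn0.
rewrite addnS => _ [x Px [y /IHk hy <-]]; rewrite mulgC; exact: setpowM.
Qed.

(** The factors that are not contained in P are trivial locally at P, and each
    of the remaining ones contributes a. *)
Lemma r_prod_local l P a : prime_s_ideal P ->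
  (forall J, J \in l -> J `<=` P -> exists2 s, ~ P s & J (s * a)) ->
  exists2 s, ~ P s & r_prod l (s * a ^+ count (below P) l).
Proof.
move=> Pp; elim: l => [_|J l IHl la].
  by exists 1 => //; exact: prime_not1.
have [K Kl|s Ps ls] := IHl; first by apply: la; exact: mem_cons.
rewrite /= /below; case: asboolP => [JP|/existsNP[x /not_implyP[Jx nPx]]] /=.
  have [t Pt Jt] := la J (mem_head _ _) JP.
  exists (t * s); first exact: prime_notinM.
  rewrite expgS mulgACA; exact: r_mul_mem.
exists (x * s); first exact: prime_notinM.
rewrite -mulgA; exact: r_mul_mem.
Qed.

End Products.

(** * From factorizations to localizations *)

Section FromFactorizations.
Variables (H : cancelMonoidType) (r : finitary_ideal_system H).
Implicit Types (X Y I J K P Q : set H) (x y z s : H) (l : seq (set H)).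

(** For b in I and u in I^-1 with bu outside Q, the identity b(uy) = (bu)y shows
    that b generates I locally at Q. *)
Lemma invertible_uniformizer Q I : prime_s_ideal Q -> r_ideal r Q ->
  r_invertible r I -> I `<=` Q ->
  (forall y, Q y -> exists2 s, ~ Q s & I (s * y)) ->
  exists a, uniformizer Q a.
Proof.
move=> Qp rQ iI IQ QI.
have [b [u [h [Ib /inv_setP uI bu Qh]]]] := prime_invertible_notin Qp rQ iI.
exists b; split; first exact: IQ.
move=> y Qy; have [s Qs Isy] := QI y Qy; have [k uk] := uI _ Isy.
exists (h * s), k; split; first exact: prime_notinM.
apply: frac_inj_injective; rewrite !frac_injM -bu -uk !frac_injM.
by comm_mul.
Qed.

Lemma invertible_nonzero Q I : prime_s_ideal Q -> r_ideal r Q ->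
  r_invertible r I -> exists2 b, I b & ~ zeros b.
Proof.
move=> Qp rQ iI.
have [b [u [h [Ib _ bu Qh]]]] := prime_invertible_notin Qp rQ iI.
exists b => //; apply: frac_factor_nonzero bu _; exact: prime_notin Qh.
Qed.

(** Krull's lemma: a divisor-closed submonoid that contains x and is maximal
    among those avoiding I has as complement a prime minimal over I.  The last
    clause is this minimality: adding y to the submonoid makes it meet I. *)
Lemma prime_over_radical I x : s_ideal I -> radical I -> ~ I x ->
  exists Q, [/\ prime_s_ideal Q, I `<=` Q, ~ Q x &
    forall y, Q y -> exists2 s, ~ Q s & I (s * y)].
Proof.
move=> sI radI nIx.
(* The empty set is admitted as the union of the empty chain. *)
pose good (S : set H) := [/\ S `<=` ~` I,
  (forall a b, S (a * b) <-> S a /\ S b) & forall z, S z -> S x].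
have [F Fgood Ftot|A [[AI AM Ax] maxA]] := @Zorn_bigcup _ [set S | good S].
  split.
  - by move=> z [S /Fgood[SI _ _] Sz]; exact: SI.
  - move=> a b; split.
      by move=> [S FS Sab]; have [_ /(_ a b)[h _] _] := Fgood S FS;
        have [Sa Sb] := h Sab; split; exists S.
    move=> [[S FS Sa] [T FT Tb]]; case: (Ftot S T FS FT) => [ST|TS].
      exists T => //; have [_ TM _] := Fgood T FT; apply/TM.
      by split=> //; exact: ST.
    exists S => //; have [_ SM _] := Fgood S FS; apply/SM.
    by split=> //; exact: TS.
  - move=> z [S FS Sz]; exists S => //.
    by have [_ _ Sx] := Fgood S FS; exact: Sx Sz.
(* The divisor-closed submonoid generated by T and y. *)
pose gen (T : set H) y := [set d | exists s n k, T s /\ s * y ^+ n = d * k].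
have gen_mul (T : set H) y : T 1 -> (forall a b, T a -> T b -> T (a * b)) ->
    forall a b, gen T y (a * b) <-> gen T y a /\ gen T y b.
  move=> T1 TM a b; split=> [[s [n [k [Ts e]]]]|].
    split; first by exists s, n, (b * k); rewrite mulgA.
    by exists s, n, (a * k); rewrite e; split=> //; comm_mul.
  move=> [[s [n [k [Ts e]]]] [t [m [j [Tt f]]]]].
  exists (s * t), (n + m)%N, (k * j); split; first exact: TM.
  by rewrite expgnDr mulgACA e f; comm_mul.
have {}Ax : A x.
  apply: contrapT => nAx; apply: (maxA (gen [set 1] x)).
    split; first by move=> z /Ax.
    move=> h; apply: nAx; apply: h.
    by exists 1, 1%N, 1; rewrite expg1 mulg1 mul1g.
  split.
  - move=> d [_ [n [k [-> e]]]] Id; apply: nIx; rewrite -radI; exists n.+1.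
    by split=> //; rewrite expgSr -[x ^+ n]mul1g e -mulgA; exact: s_idealM.
  - by apply: gen_mul => // a b -> ->; rewrite mul1g.
  - by move=> _ _; exists 1, 1%N, 1; rewrite expg1 mulg1 mul1g.
have A1 : A 1 by have /AM[] : A (1 * x) by rewrite mul1g.
exists (~` A); split.
- apply: prime_setC => // z /AI nIz zz; apply: nIz; exact: s_ideal_zeros zz.
- by move=> z Iz /AI.
- by apply.
move=> y nAy; apply: contrapT => ns; apply: (maxA (gen A y)).
  split; first by move=> z Az; exists z, 0%N, 1; rewrite expg0.
  move=> h; apply: nAy; apply: h.
  by exists 1, 1%N, 1; rewrite expg1 mulg1 mul1g.
split.
- move=> d [s [n [k [As e]]]] Id; apply: ns; exists s; first by apply.
  rewrite -radI; apply: (@rad_exp _ _ _ _ n).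
    by move=> a b; exact: s_idealM.
  by rewrite e; exact: s_idealM.
- by apply: gen_mul => // a b Aa Ab; apply/AM.
- by move=> _ _; exists x, 0%N, 1; rewrite expg0.
Qed.

Hypothesis factorization : forall I, invertible_r_ideals r I ->
  exists l, (forall J, J \in l -> r_ideal r J /\ radical J) /\ I = r_prod r l.

Lemma invertible_factorization I : invertible_r_ideals r I ->
  exists l, {in l, forall J, invertible_r_ideals r J /\ radical J} /\
    I = r_prod r l.
Proof.
move=> iI; have [l [lr IE]] := factorization iI; exists l; split=> // J Jl.
split; last by have [] := lr J Jl.
by apply: r_prod_invertible Jl; [move=> K /lr[]|rewrite -IE].
Qed.

(** A prime that contains a product contains one of the factors of xH. *)
Lemma prime_contains_radical P x : prime_s_ideal P -> ~ zeros x -> P x ->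
  exists I, [/\ invertible_r_ideals r I, radical I, I x & I `<=` P].
Proof.
move=> Pp nx Px.
have [l [lI xE]] := invertible_factorization (principal_invertible r nx).
have [|J Jl JP] := @r_prod_prime _ r l P Pp.
  by rewrite -xE => _ [k _ <-]; exact: primeMr.
have [iJ radJ] := lI J Jl; exists J; split=> //.
apply: (@r_prod_sub _ r l) => //; first by move=> K /lI[[]].
by rewrite -xE; exact: principal_mem.
Qed.

(** A radical ideal contained in P and nonzero is equal to P locally at P. *)
Lemma minimal_prime_uniformizer P : minimal_primes H P ->
  exists a, uniformizer P a.
Proof.
move=> mP; have Pp := minimal_prime_prime mP.
have [x [Px nx]] := minimal_prime_nonzero mP.
have [I [[rI iI] radI Ix IP]] := prime_contains_radical Pp nx Px.
apply: (invertible_uniformizer Pp (minimal_prime_r_ideal r mP) iI IP) => y Py.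
have [s [n [k [Ps e]]]] := minimal_prime_divides mP nx Py.
exists s => //; rewrite -radI; apply: (@rad_exp _ _ _ _ n).
  by move=> a b; exact: (r_idealM _ rI).
by rewrite e; exact: (r_idealM _ rI).
Qed.

(** A smaller nonzero prime Q' that misses a would contain a radical invertible
    ideal I.  Locally at Q, I is generated by some b in Q', and dividing twice
    by a gives b = a a d.  The square of ad is a multiple of b, so ad lies in I;
    thus b divides ad and a would be a local unit. *)
Lemma uniformizer_minimal Q a : prime_s_ideal Q -> r_ideal r Q ->
  zeros `<` Q -> uniformizer Q a -> minimal_primes H Q.
Proof.
move=> Qp rQ zQ [Qa aQ]; split=> // Q' Q'p zQ' Q'Q.
have Q'Qn s : ~ Q s -> ~ Q' s by move=> Qs /Q'Q.
case: (Q'p) => _ _ pr.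
have [Q'a|nQ'a] := pselect (Q' a).
  apply/seteqP; split=> // y /aQ[s [k [/Q'Qn Qs e]]].
  have : Q' (s * y) by rewrite e; exact: primeMr.
  by case/pr.
exfalso; case: zQ' => _ /existsNP[x /not_implyP[Q'x nx]].
have [I [[rI iI] radI Ix IQ']] := prime_contains_radical Q'p nx Q'x.
have [b [u [h [Ib /inv_setP uI bu Qh]]]] := prime_invertible_notin Qp rQ iI.
have [s [c [Qs sb]]] := aQ b (Q'Q _ (IQ' _ Ib)).
have Q'c : Q' c.
  have : Q' (a * c) by rewrite -sb; apply: primeMl => //; exact: IQ'.
  by case/pr.
have [t [d [Qt tc]]] := aQ c (Q'Q _ Q'c).
have sbE : s * t * b = a * (a * d) by rewrite -tc mulgAC sb; comm_mul.
have Iad : I (a * d).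
  rewrite -radI; exists 2; split=> //; rewrite expg2.
  rewrite (_ : a * d * _ = b * (s * t * d)); first exact: (r_idealM _ rI).
  have -> : b * (s * t * d) = s * t * b * d by comm_mul.
  by rewrite sbE; comm_mul.
have [k uk] := uI _ Iad.
have e : (a * d) * (a * k) = (a * d) * (s * t * h).
  have bk : b * k = h * (a * d).
    apply: frac_inj_injective; rewrite !frac_injM -uk -bu frac_injM.
    by comm_mul.
  rewrite (_ : a * d * (a * k) = s * t * (b * k)); last first.
    by rewrite [RHS]mulgA sbE; comm_mul.
  by rewrite bk; comm_mul.
have nad : ~ zeros (a * d).
  have nb : ~ zeros b by apply: frac_factor_nonzero bu _; exact: prime_notin Qh.
  move=> zad; have : ~ zeros (s * t * b).
    by apply: mul_nonzero => //; apply: prime_notin (prime_notinM Qp Qs Qt).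
  by rewrite sbE mulgC; apply; exact: zerosM.
have := nonzero_cancel nad e => {}e.
apply: (prime_notinM Qp (prime_notinM Qp Qs Qt) Qh).
by rewrite -e; exact: primeMr.
Qed.

(** A prime minimal over I is an r-ideal with a uniformizer, hence in X(H). *)
Lemma radical_invertible_bigcap I x : invertible_r_ideals r I -> radical I ->
  (forall P, minimal_primes H P -> I `<=` P -> P x) -> I x.
Proof.
move=> [rI iI] radI Ix; apply: contrapT => nIx.
have [Q [Qp IQ nQx QI]] := prime_over_radical (r_ideal_s_ideal rI) radI nIx.
have rQ : r_ideal r Q.
  apply: (local_rad_prime_r_ideal Qp rI IQ) => y /QI[s Qs Isy].
  by exists s, 1%N; rewrite expg1.
apply: nQx; apply: (Ix Q _ IQ).
have [a aU] := invertible_uniformizer Qp rQ iI IQ QI.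
have [b Ib nb] := invertible_nonzero Qp rQ iI.
apply: (uniformizer_minimal Qp rQ _ aU); split; first exact: prime_zeros.
by move=> h; apply/nb/h/IQ.
Qed.

(** Locally X lies in the first factor J, which is an intersection of primes in
    X(H), so X lies in J; the induction continues with the quotient of X by J.
    It is to allow this division that X is a set of elements. *)
Lemma r_prod_local_global l X :
  {in l, forall J, invertible_r_ideals r J /\ radical J} ->
  (forall x P, X x -> minimal_primes H P ->
     exists2 s, ~ P s & r_prod r l (s * x)) ->
  X `<=` r_prod r l.
Proof.
elim: l X => [//|J l IHl] X lI Xl x0 Xx0.
have [[rJ iJ] radJ] := lI J (mem_head _ _).
have XJ x : X x -> J x.
  move=> Xx; apply: radical_invertible_bigcap => // P mP JP.
  have [s Ps] := Xl x P Xx mP.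
  move=> /(r_mul_subl rJ)/JP; have [_ _ pr] := minimal_prime_prime mP.
  by case/pr.
apply: (invertible_mem iJ) (r_prod_r_ideal _ _) _ => b u h Jb uJ bu.
have [k ux] := (inv_setP _ _).1 uJ x0 (XJ _ Xx0).
rewrite (_ : x0 * h = b * k); last first.
  by apply: frac_inj_injective; rewrite !frac_injM -bu -ux; comm_mul.
apply: r_mul_mem => //.
apply: (IHl [set z | exists2 x, X x & u * x%:F = z%:F]); last by exists x0.
  by move=> K Kl; apply: lI; exact: mem_cons.
move=> z P [x Xx zE] mP; have [s Ps ls] := Xl x P Xx mP; exists s => //.
have [z' lz' e] := r_mul_div (r_prod_r_ideal r l) ls uJ.
rewrite (_ : s * z = z') //.
by apply: frac_inj_injective; rewrite -e !frac_injM -zE; comm_mul.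
Qed.

(** A fraction a/c lies in all the H_P when a lies in cH locally. *)
Lemma bigcap_localizations :
  \bigcap_(P in minimal_primes H) local_set P = range (@frac_inj H).
Proof.
apply/seteqP; split=> [u uP|_ [a _ <-] P mP]; last first.
  exact: local_set_inj (minimal_prime_prime mP) a.
have [a [c [nc e]]] := frac_denom u.
have [l [lI cE]] := invertible_factorization (principal_invertible r nc).
have : smul c setT a.
  rewrite cE; apply: (@r_prod_local_global l [set a]) => // x P -> mP.
  have [s [h [Ps sE]]] := uP P mP; exists s => //; rewrite -cE.
  exists h => //; apply: frac_inj_injective; rewrite !frac_injM -e -sE.
  by comm_mul.
move=> [h _ hE]; exists h => //; apply: (frac_cancel nc).
by rewrite -frac_injM hE -e mulgC.
Qed.

Lemma minimal_prime_DVM Q (Qprime : prime_s_ideal Q) :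
  minimal_primes H Q -> DVM (localization Qprime).
Proof.
move=> mQ; have [a aU] := minimal_prime_uniformizer mQ.
exact: uniformizer_DVM mQ aU.
Qed.

(** The factors of I, each counted once: there are k_P of them below P, and the
    others can be dropped from the product. *)
Lemma exists_meager I : invertible_r_ideals r I ->
  exists Omega : set (set H),
    [/\ Omega `<=` invertible_r_ideals r, meager r I Omega &
        rad I = \bigcap_(J in Omega) J].
Proof.
move=> iI; have [l [lI IE]] := invertible_factorization iI.
have lr : {in l, forall J, r_ideal r J} by move=> J /lI[[]].
exists [set` l]; split; first by move=> J /lI[].
  split; [exact: finite_seq|by move=> J /lI[[]]|by case: iI|].
  move=> P _; rewrite (_ : [set` l] = [set` undup l]); last first.
    by apply/seteqP; split=> J /=; rewrite mem_undup.
  rewrite count_belowE ?undup_uniq // IE.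
  apply: subset_trans (r_prod_setpow P lr) _; apply: closure_mono.
  apply: setpow_anti; rewrite -!size_filter filter_undup; exact: size_undup.
apply/seteqP; split=> [x [n [n0 Ix]] J Jl|x lx].
  have [_ <-] := lI J Jl; exists n; split=> //.
  by apply: (r_prod_sub lr Jl); rewrite -IE.
exists (size l).+1; split=> //; rewrite IE expgSr; apply: r_idealM.
  exact: r_prod_r_ideal.
exact: r_prod_exp.
Qed.

End FromFactorizations.

(** * From localizations to factorizations *)

Section FromLocalizations.
Variables (H : cancelMonoidType) (r : finitary_ideal_system H).
Implicit Types (X Y I J K P Q : set H) (x y z s : H) (l : seq (set H)).

Lemma r_prod_cat l l' : r_prod r (l ++ l') = r_mul r (r_prod r l) (r_prod r l').
Proof.
elim: l => [|J l IHl] /=.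
  by rewrite r_mulC /r_mul (r_ideal_mulT (r_prod_r_ideal r l')) r_prod_r_ideal.
by rewrite IHl /r_mul closure_mulr closure_mull setmulA.
Qed.

Lemma setpow_uniformizer P a k z : prime_s_ideal P -> uniformizer P a ->
  setpow P k z -> exists s h, ~ P s /\ s * z = a ^+ k * h.
Proof.
move=> Pp [_ aP]; elim: k z => [|k IHk] z.
  by exists 1, z; split=> //; exact: prime_not1.
move=> [y Py [w /IHk[t [g [Pt tw]]] <-]]; have [s [h [Ps sy]]] := aP y Py.
exists (s * t), (h * g); split; first exact: prime_notinM.
by rewrite mulgACA sy tw expgS; comm_mul.
Qed.

Hypothesis bigcapH :
  \bigcap_(P in minimal_primes H) local_set P = range (@frac_inj H).

(** K^-1 x lies in every H_P, hence in H, and K K^-1 has closure H. *)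
Lemma invertible_local_global K x : invertible_r_ideals r K ->
  (forall P, minimal_primes H P -> exists2 s, ~ P s & K (s * x)) -> K x.
Proof.
move=> [rK iK] Kx; apply: (invertible_mem iK rK) => b u h Kb /inv_setP uK bu.
have [k _ kE] : range frac_inj (u * x%:F).
  rewrite -bigcapH => P mP; have [s Ps /uK[k sk]] := Kx P mP.
  by exists s, k; split=> //; rewrite -sk frac_injM; comm_mul.
rewrite (_ : x * h = b * k); first exact: (r_idealM _ rK).
by apply: frac_inj_injective; rewrite !frac_injM -bu kE; comm_mul.
Qed.

Hypothesis uniformizers : forall P, minimal_primes H P ->
  exists a, uniformizer P a.

Section Meager.
Variables (I : set H) (l : seq (set H)).
Hypotheses (iI : invertible_r_ideals r I)
  (lI : {in l, forall J, invertible_r_ideals r J})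
  (radI : rad I = \bigcap_(J in [set` l]) J).

Lemma rad_subset J : J \in l -> rad I `<=` J.
Proof. by rewrite radI => Jl x; exact. Qed.

(** A nonzero element of I divides, up to s, a power of y. *)
Lemma rad_local P y : minimal_primes H P -> P y ->
  exists2 s, ~ P s & rad I (s * y).
Proof.
move=> mP Py; have Pp := minimal_prime_prime mP.
case: (iI) => rI rinvI.
have [b Ib nb] := invertible_nonzero Pp (minimal_prime_r_ideal r mP) rinvI.
have [s [n [k [Ps e]]]] := minimal_prime_divides mP nb Py.
exists s => //; apply: (@rad_exp _ _ _ _ n).
  by move=> a c; exact: (r_idealM _ rI).
by rewrite e; exact: (r_idealM _ rI).
Qed.

Lemma member_local J P y : J \in l -> minimal_primes H P -> P y ->
  exists2 s, ~ P s & J (s * y).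
Proof.
move=> Jl mP Py; have [s Ps Isy] := rad_local mP Py.
by exists s => //; exact: rad_subset Isy.
Qed.

(** Locally at a prime P in X(H) that contains it, J contains P, by
    [member_local]. *)
Lemma member_radical J : J \in l -> radical J.
Proof.
move=> Jl; apply/seteqP; split; last exact: subset_rad.
move=> x [n [_ Jxn]]; apply: (invertible_local_global (lI Jl)) => P mP.
have [JP|/existsNP[t /not_implyP[Jt Pt]]] := pselect (J `<=` P).
  apply: member_local => //.
  exact: (prime_exp (minimal_prime_prime mP) (JP _ Jxn)).
by exists t => //; have [rJ _] := lI Jl; exact: (r_idealM _ rJ).
Qed.

Lemma r_prod_local_exp P y : minimal_primes H P -> P y ->
  exists2 s, ~ P s & r_prod r l (s * y ^+ count (below P) l).
Proof.
move=> mP Py; apply: r_prod_local (minimal_prime_prime mP) _ => J Jl _.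
exact: member_local.
Qed.

(** Locally at P, I lies in the k_P-th power of the maximal ideal, and k_P
    factors of the product are equal to this maximal ideal. *)
Lemma meager_subset_r_prod :
  (forall P x, minimal_primes H P -> I x ->
     exists2 s, ~ P s & setpow P (count (below P) l) (s * x)) ->
  I `<=` r_prod r l.
Proof.
move=> mI x Ix; apply: (invertible_local_global (invertible_r_prod lI)) => P mP.
have Pp := minimal_prime_prime mP; have [a aU] := uniformizers mP.
have [s Ps sx] := mI P x mP Ix.
have [t [h [Pt e]]] := setpow_uniformizer Pp aU sx.
have [v Pv va] := r_prod_local_exp mP aU.1.
exists (v * (t * s)); first by apply: prime_notinM => //; exact: prime_notinM.
rewrite (_ : v * (t * s) * x = v * a ^+ count (below P) l * h).
  exact: (r_idealM _ (r_prod_r_ideal _ _)).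
by rewrite -[RHS]mulgA -e; comm_mul.
Qed.

Lemma r_prod_sub_rad : r_prod r l `<=` rad I.
Proof.
rewrite radI => x lx J Jl; apply: (r_prod_sub _ Jl lx).
by move=> K /lI[].
Qed.

End Meager.

(** For the valuations v_P of the monoids H_P, this is v_P(I) <= n. *)
Definition valuation_le I n : Prop :=
  forall P y, minimal_primes H P -> P y -> exists2 s, ~ P s & I (s * y ^+ n).

(** If the n-th power of K = prod l lies in I, then v_P(I) <= n v_P(K), and
    v_P(K) is at most the length of l. *)
Lemma exists_valuation_le I l : invertible_r_ideals r I ->
  {in l, forall J, invertible_r_ideals r J} ->
  rad I = \bigcap_(J in [set` l]) J -> exists n, valuation_le I n.
Proof.
move=> iI lI radI; have [rI _] := iI.
have [n lIn] := invertible_rad_exp (invertible_r_prod lI) rI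
  (r_prod_sub_rad lI radI).
exists (size l * n)%N => P y mP Py.
have [s Ps lsy] := r_prod_local_exp iI radI mP Py.
exists (s ^+ n); first by apply: prime_notin_exp Ps; exact: minimal_prime_prime.
rewrite expgnA -expgMC; apply: lIn.
rewrite -(subnKC (count_size (below P) l)) expgnDr mulgA.
exact: (r_idealM _ (r_prod_r_ideal _ _)).
Qed.

(** If I is contained in P, so is the product K = prod l: thus K is generated,
    locally at P, by some b that a divides.  Locally I contains a^(n+1), hence
    its multiple b a^n, and cancelling b puts a^n into I'.  If I is not
    contained in P, neither is I'. *)
Lemma valuation_le_div I I' l n : invertible_r_ideals r I ->
  {in l, forall J, invertible_r_ideals r J} ->
  rad I = \bigcap_(J in [set` l]) J -> r_ideal r I' ->
  I = r_mul r (r_prod r l) I' -> valuation_le I n.+1 -> valuation_le I' n.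
Proof.
move=> iI lI radI rI' IE vI P y mP Py; have Pp := minimal_prime_prime mP.
have [IP|/existsNP[x /not_implyP[Ix Px]]] := pselect (I `<=` P); last first.
  exists x => //; apply: (r_idealM _ rI'); move: Ix.
  by rewrite IE r_mulC; exact: r_mul_subl.
have lP : r_prod r l `<=` P.
  by move=> x /(r_prod_sub_rad lI radI)[m [_ /IP]]; exact: prime_exp.
have [_ il] := invertible_r_prod lI.
have [b [u [h [lb ul bu Ph]]]] :=
  prime_invertible_notin Pp (minimal_prime_r_ideal r mP) il.
have [a aU] := uniformizers mP; have [Pa aP] := aU.
have [s Ps Isa] := vI P a mP Pa; rewrite IE in Isa.
have [k I'k ke] := r_mul_div rI' Isa ul.
have [t [c [Pt tb]]] := aP b (lP _ lb).
have [v [w [Pv vy]]] := uniformizer_exp n Pp aU Py.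
exists (v * (t * (h * s))).
  by do !apply: prime_notinM.
have ck : t * h * s * a ^+ n = c * k.
  apply: frac_inj_injective; rewrite [RHS]frac_injM -ke !frac_injM -bu.
  have := congr1 frac_inj tb; rewrite !frac_injM => tb'.
  transitivity (t%:F * b%:F * u * s%:F * (a ^+ n)%:F); first by comm_mul.
  by rewrite tb' expgS frac_injM; comm_mul.
rewrite (_ : v * _ * _ = k * (c * w)); first exact: (r_idealM _ rI').
transitivity (t * h * s * (v * y ^+ n)); first by comm_mul.
by rewrite vy mulgA ck; comm_mul.
Qed.

Hypothesis meagers : forall I, invertible_r_ideals r I ->
  exists Omega : set (set H),
    [/\ Omega `<=` invertible_r_ideals r, finite_set Omega,
        rad I = \bigcap_(J in Omega) J &
        forall P x, minimal_primes H P -> I x ->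
          exists2 s, ~ P s & setpow P (count_below Omega P) (s * x)].

Lemma exists_meager_seq I : invertible_r_ideals r I ->
  exists l, [/\ {in l, forall J, invertible_r_ideals r J},
    rad I = \bigcap_(J in [set` l]) J & I `<=` r_prod r l].
Proof.
move=> iI; have [Omega [OI /finite_seqP[l0 OE] radI mI]] := meagers iI.
have lE : Omega = [set` undup l0].
  by rewrite OE; apply/seteqP; split=> J /=; rewrite mem_undup.
rewrite {OE}lE in OI radI mI.
exists (undup l0); split=> //.
apply: (meager_subset_r_prod iI) => // P x mP Ix.
by rewrite -count_belowE ?undup_uniq //; exact: mI.
Qed.

(** By induction on the bound of the valuations of I. *)
Lemma factorization_of_meager I : invertible_r_ideals r I ->
  exists l, (forall J, J \in l -> r_ideal r J /\ radical J) /\ I = r_prod r l.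
Proof.
move=> iI.
have [n vI] : exists n, valuation_le I n.
  have [l [lI radI _]] := exists_meager_seq iI.
  exact: exists_valuation_le radI.
elim: n I iI vI => [|n IHn] I iI vI.
  exists [::]; split=> //; apply/seteqP; split=> // x _.
  apply: (invertible_local_global iI) => P mP.
  have [y [Py _]] := minimal_prime_nonzero mP.
  have [s Ps] := vI P y mP Py; rewrite expg0 mulg1 => Is.
  by exists s => //; have [rI _] := iI; exact: (r_idealM _ rI).
have [l [lI radI Il]] := exists_meager_seq iI.
have [I' iI' IE] := invertible_divides iI (invertible_r_prod lI) Il.
have [l' [l'I I'E]] := IHn I' iI' (valuation_le_div iI lI radI iI'.1 IE vI).
exists (l ++ l'); split; last by rewrite r_prod_cat -I'E.
move=> J; rewrite mem_cat => /orP[Jl|]; last exact: l'I.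
by split; [have [] := lI J Jl|exact: (member_radical iI lI radI)].
Qed.

End FromLocalizations.

(** * The monoid of invertible ideals *)

Lemma map_preimage (T : Type) (U : eqType) (f : T -> U) (s : seq U) :
  {in s, forall y, exists x, f x = y} -> exists l, map f l = s.
Proof.
elim: s => [|y s IHs] sf; first by exists [::].
have [x <-] := sf y (mem_head _ _).
have [|l <-] := IHs; last by exists (x :: l).
by move=> z zs; apply: sf; exact: mem_cons.
Qed.

Section InvertibleMonoid.
Variables (H : cancelMonoidType) (r : finitary_ideal_system H).
Local Notation M := (inv_ideal r).
Implicit Types (I J K : M) (l : seq M).

Definition to_inv_ideal (X : set H) (iX : invertible_r_ideals r X) : M :=
  exist _ X (mem_set iX).

Lemma inv_ideal_dvd I J : smul J setT I <-> val I `<=` val J.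
Proof.
have [rJ _] := inv_idealP J.
split=> [[K _ <-]|IJ]; first exact: r_mul_subl.
have [K iK IE] := invertible_divides (inv_idealP I) (inv_idealP J) IJ.
by exists (to_inv_ideal iK) => //; exact: val_inj.
Qed.

Lemma inv_ideal_principal_inj I J : smul I (@setT M) = smul J setT -> I = J.
Proof.
move=> IJ; apply/val_inj/seteqP.
by split; apply/inv_ideal_dvd; [rewrite -IJ|rewrite IJ]; exact: principal_mem.
Qed.

Lemma inv_ideal_exp I x n : val I x -> val (I ^+ n) (x ^+ n).
Proof. by move=> Ix; elim: n => // n IHn; rewrite !expgS; exact: r_mul_mem. Qed.

Lemma to_inv_ideal_exp x (nx : ~ zeros x) n :
  val (to_inv_ideal (principal_invertible r nx) ^+ n) = smul (x ^+ n) setT.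
Proof.
elim: n => [|n IHn].
  by apply/seteqP; split=> // y _; exists y; rewrite ?mul1g.
by rewrite !expgS -(r_mul_principal r) -IHn.
Qed.

(** For the direct implication an element x is replaced with the ideal xH, which
    is invertible when x is nonzero. *)
Lemma inv_ideal_radical J : radical (smul J (@setT M)) <-> radical (val J).
Proof.
have [rJ _] := inv_idealP J.
split=> radJ; apply/seteqP; split; try exact: subset_rad.
  move=> x [n [n0 Jxn]].
  have [|nx] := pselect (zeros x).
    exact: s_ideal_zeros (r_ideal_s_ideal rJ) _.
  have : smul J setT (to_inv_ideal (principal_invertible r nx)).
    rewrite -radJ; exists n; split=> //; apply/inv_ideal_dvd.
    by rewrite to_inv_ideal_exp => _ [k _ <-]; exact: (r_idealM _ rJ).
  by move=> /inv_ideal_dvd; apply; exact: principal_mem.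
move=> K [n [n0 /inv_ideal_dvd KJ]]; apply/inv_ideal_dvd => x Kx.
by rewrite -radJ; exists n; split=> //; apply: KJ; exact: inv_ideal_exp.
Qed.

Lemma r_prod_val l : r_prod r (map val l) = val (foldr *%g 1 l).
Proof. by elim: l => //= J l ->. Qed.

Lemma radical_factorial_inv_ideal : radical_factorial M <->
  forall X, invertible_r_ideals r X -> exists s : seq (set H),
    (forall Y, Y \in s -> r_ideal r Y /\ radical Y) /\ X = r_prod r s.
Proof.
rewrite radical_factorialP; split=> [RF X iX|fact I].
  have [l [lP /inv_ideal_principal_inj XE]] := RF (to_inv_ideal iX).
  exists (map val l); split; last by rewrite r_prod_val -XE.
  move=> _ /mapP[J Jl ->]; have [rJ _] := inv_idealP J.
  by split=> //; apply/inv_ideal_radical; exact: lP.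
have [s [sP IE]] := invertible_factorization fact (inv_idealP I).
have [|l lE] := @map_preimage M _ val s.
  by move=> Y /sP[iY _]; exists (to_inv_ideal iY).
exists l; split; last first.
  by congr (smul _ _); apply: val_inj; rewrite IE -r_prod_val lE.
move=> J Jl; apply/inv_ideal_radical; apply: (sP _ _).2.
by rewrite -lE; exact: map_f.
Qed.

End InvertibleMonoid.

(** * The system of all s-ideals *)

Section SSystem.
Variable H : cancelMonoidType.
Implicit Types (X Y I J P : set H) (x y z s : H).

Definition s_closure X : set H := setmul X setT `|` zeros.

Lemma s_closure_le X Y : X `<=` s_closure Y -> s_closure X `<=` s_closure Y.
Proof.
move=> XY z [[x /XY[[y Yy [a _ <-]]|zx] [b _ <-]]|]; last by right.
  by left; exists y => //; exists (a * b); rewrite ?mulgA.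
by right; exact: zerosM.
Qed.

Lemma s_closure_smul c X : smul c (s_closure X) = s_closure (smul c X).
Proof.
apply/seteqP; split=> [_ [z [[x Xx [a _ <-]]|zz] <-]|z].
- by left; exists (c * x); [exists x|exists a; rewrite ?mulgA].
- by right; rewrite mulgC; exact: zerosM.
move=> [[_ [x Xx <-] [a _ <-]]|zz]; last first.
  by exists z; [right|rewrite mulgC zz].
by exists (x * a); [left; exists x => //; exists a|rewrite mulgA].
Qed.

Lemma s_closure_finitary X : s_closure X =
  \bigcup_(E in [set E | E `<=` X /\ finite_set E]) s_closure E.
Proof.
apply/seteqP; split=> [z [[x Xx [a _ <-]]|zz]|z [E [EX _]]].
- exists [set x]; first by split=> // _ ->.
  by left; exists x => //; exists a.
- by exists set0; [split=> //; exact: finite_set0|right].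
- move=> [[x /EX Xx [a _ <-]]|]; last by right.
  by left; exists x => //; exists a.
Qed.

Definition s_system : finitary_ideal_system H :=
  FinitaryIdealSystem (fun X => @subset_refl _ (s_closure X)) s_closure_le
    s_closure_smul s_closure_finitary.

(** The identity b u h = 1, with b in I and u in I^-1, gives I = bH. *)
Lemma s_system_invertible I : invertible_r_ideals s_system I ->
  exists2 x, ~ zeros x & I = smul x setT.
Proof.
move=> [rI iI]; have : s_system (mul_inv I) 1 by rewrite iI.
case=> [[y /mul_invP[b [u [Ib /inv_setP uI bu]]] [h _ yh]]|]; last first.
  by move=> /one_nonzero.
have ny : ~ zeros y.
  by apply: (@nonzeroM_l _ _ h); rewrite yh; exact: one_nonzero.
exists b; first exact: frac_factor_nonzero bu ny.
apply/seteqP; split=> [x Ix|_ [k _ <-]]; last exact: (r_idealM _ rI).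
have [k ux] := uI x Ix; exists (k * h) => //.
apply: frac_inj_injective; rewrite mulgA frac_injM -[in RHS](mulg1 x) -yh.
by rewrite !frac_injM -ux -bu; comm_mul.
Qed.

Lemma smul_zeros x : zeros x -> smul x setT = @zeros H.
Proof.
move=> zx; apply/seteqP; split=> [_ [a _ <-]|z zz]; first exact: zerosM.
by exists x => //; rewrite zx; exact: zeros_uniq.
Qed.

Lemma radical_zeros : radical (@zeros H).
Proof.
apply/seteqP; split; last exact: subset_rad.
by move=> x [n [_ zxn]]; apply: contrapT => /(@nonzero_exp _ _ n).
Qed.

Lemma r_prod_principal (r : finitary_ideal_system H) (l : seq H) :
  r_prod r [seq smul x setT | x <- l] = smul (foldr *%g 1 l) setT.
Proof.
elim: l => [|x l IHl] /=; last by rewrite IHl r_mul_principal.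
by apply/seteqP; split=> // y _; exists y; rewrite ?mul1g.
Qed.

Lemma radical_factorial_s_system : radical_factorial H <->
  forall I, invertible_r_ideals s_system I -> exists l : seq (set H),
    (forall J, J \in l -> r_ideal s_system J /\ radical J) /\
    I = r_prod s_system l.
Proof.
rewrite radical_factorialP; split=> [RF I /s_system_invertible[x nx ->]|fact x].
  have [l [lP xE]] := RF x.
  exists [seq smul y setT | y <- l]; rewrite r_prod_principal; split=> //.
  by move=> _ /mapP[y yl ->]; split; [exact: principal_r_ideal|exact: lP].
have [zx|nx] := pselect (zeros x).
  exists [:: x]; rewrite /= mulg1; split=> // y; rewrite inE => /eqP ->.
  by rewrite smul_zeros //; exact: radical_zeros.
have [s [sP xE]] := invertible_factorization fact (principal_invertible _ nx).
have [|l lE] := @map_preimage H _ (fun x => smul x setT) s.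
  by move=> J /sP[/s_system_invertible[y _ ->] _]; exists y.
exists l; split; last by rewrite xE -(r_prod_principal s_system) lE.
move=> y yl; apply: (sP _ _).2; rewrite -lE.
by apply: (map_f (fun x => smul x setT)).
Qed.

End SSystem.

(** * Closures of prime powers *)

Section PrimePowers.
Variable H : cancelMonoidType.
Implicit Types (X Y I J P : set H) (x y z s : H).

Lemma setpow_zeros P k : zeros `<=` P -> zeros `<=` setpow P k.
Proof.
move=> zP; elim: k => // k IHk z zz; exists z; first exact: zP.
by exists z; [exact: IHk|rewrite zz].
Qed.

Lemma setpow_divisible P a k z : uniformizer P a ->
  setpow P k (a ^+ k * z).
Proof. by move=> [Pa _]; apply/setpowM/setpow_exp. Qed.

Lemma finite_setpow_local P a k (E : set H) : prime_s_ideal P ->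
  uniformizer P a -> finite_set E -> E `<=` setpow P k ->
  exists2 s, ~ P s & forall e, E e -> exists h, s * e = a ^+ k * h.
Proof.
move=> Pp aU /finite_seqP[l ->] lP.
have [||||s Ps sl] := @common_denominator _ (~` P) (smul (a ^+ k) setT) l.
- exact: prime_not1.
- by move=> s t; exact: prime_notinM.
- by move=> _ y [h _ <-]; exists (h * y); rewrite ?mulgA.
- move=> e /lP Pe; have [s [h [Ps e1]]] := setpow_uniformizer Pp aU Pe.
  by exists s => //; exists h.
by exists s => // e /sl[h _ <-]; exists h.
Qed.

(** Finitely many elements of P^k have a common denominator s with which they
    become multiples of a^k, and a^k H is an r-ideal. *)
Lemma closure_setpow_local (r : finitary_ideal_system H) P a k x :
  prime_s_ideal P -> uniformizer P a -> r (setpow P k) x ->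
  exists2 s, ~ P s & setpow P k (s * x).
Proof.
move=> Pp aU; rewrite closure_finitary => -[E [EP Efin] Ex].
have [s Ps sE] := finite_setpow_local Pp aU Efin EP; exists s => //.
have : smul (a ^+ k) setT (s * x); last first.
  by move=> [h _ <-]; exact: setpow_divisible.
apply: (r_ideal_mul (principal_r_ideal r _)) Ex => e /sE[h ->].
by exists h.
Qed.

(** A nonzero element of P would be a unit. *)
Lemma minimal_prime_proper P : minimal_primes H P ->
  range (@frac_inj H) <> setT.
Proof.
move=> mP rE; have [x [Px nx]] := minimal_prime_nonzero mP.
have Pp := minimal_prime_prime mP.
have [y xy] := frac_inj_inv nx.
have [h _ hy] : range (@frac_inj H) y by rewrite rE.
apply: (prime_not1 Pp); rewrite (_ : 1 = x * h); first exact: primeMr.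
by apply: frac_inj_injective; rewrite frac_injM hy xy.
Qed.

(** With s as in [finite_setpow_local], s / a^k lies in E^-1. *)
Lemma t_closure_setpow_local P a k x :
  minimal_primes H P -> uniformizer P a -> t_closure (setpow P k) x ->
  exists2 s, ~ P s & setpow P k (s * x).
Proof.
move=> mP aU; have Pp := minimal_prime_prime mP.
rewrite /t_closure; case: pselect => [rE|nG].
  by case: (minimal_prime_proper mP rE).
move=> [E [EP Efin] vEx].
have [s Ps sE] := finite_setpow_local Pp aU Efin EP; exists s => //.
have na := uniformizer_nonzero Pp mP aU.
have [w aw] := frac_inj_inv (nonzero_exp (n := k) na).
have [|h _ xh] := vEx (x%:F * (s%:F * w)).
  exists (s%:F * w) => //; apply/inv_setP => e /sE[h e1]; exists h.
  have := congr1 frac_inj e1; rewrite !frac_injM => e2.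
  rewrite (_ : _ * _ = s%:F * e%:F * w); last by comm_mul.
  by rewrite e2 mulgAC aw mul1g.
rewrite (_ : s * x = a ^+ k * h); first exact: setpow_divisible.
apply: frac_inj_injective; rewrite !frac_injM xh.
transitivity ((a ^+ k)%:F * w * (s%:F * x%:F)); first by rewrite aw mul1g.
by comm_mul.
Qed.

Lemma subset_t_closure X : X `<=` t_closure X.
Proof.
move=> x Xx; rewrite /t_closure; case: pselect => hG /=.
  by case: pselect => // Xz; exact: Xz.
exists [set x]; first by split=> // _ ->.
move=> _ [z /inv_setP xz <-]; have [h zx] := xz x erefl.
by exists h; rewrite // mulgC.
Qed.

(** If some nonzero x were in the v-closure of zero, whose inverse is the whole
    quotient monoid G, then xG = G would be contained in H. *)
Lemma t_closure_zeros : t_closure (@zeros H) = zeros.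
Proof.
apply/seteqP; split; last exact: subset_t_closure.
rewrite /t_closure; case: pselect => [rE|nG] /=.
  by case: pselect => // nz; case: nz.
move=> x [E [Ez _] vx]; apply: contrapT => nx; apply: nG.
apply/seteqP; split=> // g _; have [w xw] := frac_inj_inv nx.
apply: vx; exists (w * g); last by rewrite mulgA xw mul1g.
apply/inv_setP => e /Ez ze; exists e.
have [a [s [ns e1]]] := frac_denom (w * g).
apply: (frac_cancel ns); rewrite mulgA [s%:F * (w * g)]mulgC e1 -!frac_injM.
by rewrite mulgC ze mulgC ze.
Qed.

Lemma principal_t_ideal J : principal J -> r_ideal t_closure J.
Proof.
move=> pJ; have [nJ|JE] := pselect (exists x, J x); last first.
  suff -> : J = zeros by exact: t_closure_zeros.
  case: pJ => A [_ AE]; apply/seteqP; split=> z Jz; first by case: JE; exists z.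
  by rewrite AE; right.
have [y {pJ nJ}->] := principal_nonempty pJ nJ.
have [zy|ny] := pselect (zeros y).
  by rewrite smul_zeros //; exact: t_closure_zeros.
apply/seteqP; split; last exact: subset_t_closure.
have [w yw] := frac_inj_inv ny.
rewrite /t_closure; case: pselect => [rE|nG] /=.
  have [h _ hE] : range frac_inj w by rewrite rE.
  move=> x _; exists (h * x) => //; apply: frac_inj_injective.
  by rewrite !frac_injM hE mulgA yw mul1g.
move=> x [E [Ey _] vx].
have [|h _ xw] := vx (x%:F * w).
  exists w => //; apply/inv_setP => e /Ey[k _ <-]; exists k.
  by rewrite frac_injM mulgA [w * _]mulgC yw mul1g.
exists h => //; apply: frac_inj_injective; rewrite frac_injM xw.
by rewrite mulgCA yw mulg1.
Qed.

End PrimePowers.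

(** * The characterizations *)

Lemma minimal_primes_uniformizer (H : cancelMonoidType) :
  (forall (Q : set H) (Qprime : prime_s_ideal Q),
     minimal_primes H Q -> DVM (localization Qprime)) ->
  forall P : set H, minimal_primes H P -> exists a, uniformizer P a.
Proof.
move=> dvm P mP.
exact: DVM_uniformizer mP (dvm P (minimal_prime_prime mP) mP).
Qed.

Theorem proposition5p2 (H : cancelMonoidType) (r : finitary_ideal_system H) :
  let localizations_ok :=
    \bigcap_(P in minimal_primes H) local_set P = range (@frac_inj H) /\
    (forall (Q : set H) (Qprime : prime_s_ideal Q),
       minimal_primes H Q -> DVM (localization Qprime)) in
  let A1 := radical_factorial (inv_ideal r) in
  let A2 := forall I : set H, invertible_r_ideals r I ->
    exists s : seq (set H),
      (forall J, J \in s -> r_ideal r J /\ radical J) /\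
      I = foldr (r_mul r) setT s in
  let A3 := localizations_ok /\
    forall I : set H, invertible_r_ideals r I ->
      exists Omega : set (set H),
        [/\ Omega `<=` invertible_r_ideals r, meager r I Omega &
            rad I = \bigcap_(J in Omega) J] in
  ((A1 <-> A2) /\ (A2 <-> A3)) /\
  (radical_factorial H <->
   localizations_ok /\
   forall x : H, exists Omega : set (set H),
     [/\ Omega `<=` principal, meager t_closure (smul x setT) Omega &
         rad (smul x setT) = \bigcap_(J in Omega) J]).
Proof.
move=> localizations_ok A1 A2 A3; split; first split.
- exact: radical_factorial_inv_ideal.
- split=> [fact|[[bigcapH dvm] meagers]].
    split; last exact: exists_meager fact.
    split; first exact: bigcap_localizations fact.
    by move=> Q Qp mQ; exact: minimal_prime_DVM fact _ Qp mQ.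
  have unif := minimal_primes_uniformizer dvm.
  apply: (factorization_of_meager bigcapH unif) => I iI.
  have [Omega [OI [Ofin _ _ mI] radI]] := meagers I iI.
  exists Omega; split=> // P x mP Ix; have [a aU] := unif P mP.
  by apply: closure_setpow_local (minimal_prime_prime mP) aU _; exact: mI.
- rewrite radical_factorial_s_system; split=> [fact|[[bigcapH dvm] meagers]].
    split.
      split; first exact: bigcap_localizations fact.
      by move=> Q Qp mQ; exact: minimal_prime_DVM fact _ Qp mQ.
    move=> x; have [zx|nx] := pselect (zeros x).
      (* The zero ideal is not invertible, but it is its own radical. *)
      exists [set zeros]; rewrite smul_zeros //; split.
      + by move=> _ ->; rewrite -(smul_zeros zx); exact: principal_smul.
      + have t0 := @t_closure_zeros H.
        split=> //; first by move=> _ ->.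
        move=> P mP; apply: subset_trans (@subset_t_closure _ _).
        apply: setpow_zeros; exact: prime_zeros (minimal_prime_prime mP).
      + by rewrite bigcap_set1; exact: radical_zeros.
    have [Omega [OI [Ofin _ _ mI] radI]] :=
      exists_meager fact (principal_invertible _ nx).
    have OP : Omega `<=` principal.
      by move=> J /OI/s_system_invertible[y _ ->]; exact: principal_smul.
    exists Omega; split=> //; split=> //.
    + by move=> J /OP; exact: principal_t_ideal.
    + exact: principal_t_ideal (principal_smul x).
    move=> P mP; apply: subset_trans (mI P mP) _ => y hy.
    apply: subset_t_closure; case: hy => [[z Pz [b _ <-]]|zy].
      exact: setpowM.
    by apply: setpow_zeros zy; exact: prime_zeros (minimal_prime_prime mP).
  have unif := minimal_primes_uniformizer dvm.
  apply: (factorization_of_meager bigcapH unif).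
  move=> I /s_system_invertible[x nx ->].
  have [Omega [OP [Ofin _ _ mI] radI]] := meagers x.
  exists Omega; split=> //; last first.
    move=> P y mP Iy; have [a aU] := unif P mP.
    by apply: (t_closure_setpow_local mP aU); exact: (mI P mP y Iy).
  move=> J OJ; have Jx : J x.
    have : rad (smul x setT) x by apply/subset_rad/principal_mem.
    by rewrite radI; exact.
  have [y JE] := principal_nonempty (OP J OJ) (ex_intro _ x Jx).
  rewrite JE; apply: principal_invertible; move: Jx; rewrite JE => -[b _ e].
  by apply: (@nonzeroM_l _ _ b); rewrite e.
Qed.
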